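(* Let $\Delta$ be the clique complex of a chordal graph on $N$ vertices with at least two maximal cliques, and let $c$ be the number of connected components of $\Delta$, equivalently of its $1$-skeleton. Then $\Delta^\vee$ is shellable, and $$\widetilde H_q(\Delta^\vee;\mathbb Z)=0\qquad(q\ne N-3),$$ while $$\widetilde H_{N-3}(\Delta^\vee;\mathbb Z)\cong\mathbb Z^{c-1}.$$ If $N\ge3$, then $$\Delta^\vee\simeq\bigvee^{c-1}S^{N-3}.$$ In particular, the dual is contractible when $\Delta$ is connected. Its reduced Euler characteristic is $$\widetilde\chi(\Delta^\vee)=(-1)^{N-3}(c-1).$$
   Context: A simplicial complex $\Sigma$ on a finite set $X$ is a collection of subsets (faces) of $X$ closed under inclusion; elements of $X$ not lying in any face (ghost vertices) are allowed. A face $F$ has dimension $|F|-1$. The clique complex of a finite graph with vertex set $X$ consists of its cliques. The Alexander dual on $X$ is $\Sigma^\vee=\{F\subseteq X:X\setminus F\notin\Sigma\}$; here $|X|=N$. The reduced Euler characteristic is $\widetilde\chi(\Sigma)=\sum_{q\ge-1}(-1)^qf_q$, where $f_q$ is the number of $q$-dimensional faces ($f_{-1}=1$). $\bigvee^{t}S^k$ is a wedge of $t$ copies of the $k$-sphere (a point if $t=0$). *)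

(* Defs.v *)
From HB Require Import structures.
From mathcomp Require Import all_boot all_order all_algebra.
From mathcomp Require Import generic_quotient ring_quotient.
From mathcomp Require Import all_classical all_reals all_analysis.
From mathcomp Require Import homotopy.
Import Order.TTheory GRing.Theory Num.Theory.
Import numFieldNormedType.Exports.

Set Implicit Arguments.
Unset Strict Implicit.
Unset Printing Implicit Defensive.

Local Open Scope ring_scope.
Local Open Scope set_scope.

(* The ground set is all of X : elements x with [set x] not a face are ghost
   vertices.  The void complex (no face at all) is not excluded. *)
Record complex (X : finType) := Complex {
  faces :> {set {set X}};
  faces_closed : forall F G : {set X}, F \in faces -> G \subset F -> G \in faces }.

Section Combinatorics.
Variable X : finType.
Implicit Types (e : rel X) (K : complex X).

Definition is_clique e (A : {set X}) : bool :=
  [forall x in A, forall y in A, (x != y) ==> e x y].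

Definition maximal_cliques e : {set {set X}} :=
  [set A | maxset (is_clique e) A].

(* Every cycle of length at least 4 has a chord, i.e. an edge between two of
   its vertices that are not consecutive on it. *)
Definition chordal e : Prop :=
  forall s : seq X, (4 <= size s)%N -> ucycle e s ->
    exists x y, [/\ x \in s, y \in s, e x y, y != next s x & x != next s y].

Lemma clique_faces_closed e (F G : {set X}) :
  F \in [set A | is_clique e A] -> G \subset F -> G \in [set A | is_clique e A].
Proof.
rewrite !inE => /forall_inP FP /fintype.subsetP GF.
by apply/forall_inP => x /GF/FP/forall_inP Fx; apply/forall_inP => y /GF/Fx.
Qed.

Definition clique_complex e : complex X := Complex (@clique_faces_closed e).

Lemma dual_faces_closed K (F G : {set X}) :
  F \in [set A | ~: A \notin K] -> G \subset F -> G \in [set A | ~: A \notin K].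
Proof.
rewrite !inE => FK GF; apply: contra FK => /faces_closed; apply.
by rewrite finset.setCS.
Qed.

Definition alexander_dual K : complex X := Complex (@dual_faces_closed K).

Definition skeleton1 K : rel X := [rel x y | (x != y) && ([set x; y] \in K)].

(* Connected components of a complex are those of its 1-skeleton; ghost
   vertices do not count. *)
Definition num_components K : nat :=
  n_comp (skeleton1 K) [pred x | [set x] \in K].

Definition facets (S : {set {set X}}) : {set {set X}} :=
  [set F in S | [forall G in S, (F \subset G) ==> (G == F)]].

(* All facets have n elements, i.e. dimension n - 1. *)
Definition pure (n : nat) (S : {set {set X}}) : Prop :=
  forall F, F \in facets S -> #|F| = n.

(* Classical (pure) shellability: the facets have a common dimension d and can
   be listed so that each one after the first meets the subcomplex generated by
   its predecessors in a pure (d - 1)-dimensional complex. *)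
Definition shelling_order (n : nat) (s : seq {set X}) : Prop :=
  forall j, (0 < j < size s)%N ->
    exists2 m, n = m.+1 &
      pure m [set G : {set X} | (G \subset nth finset.set0 s j)
                              && has (fun F : {set X} => G \subset F) (take j s)].

Definition shellable K : Prop :=
  exists (n : nat) (s : seq {set X}),
    [/\ pure n K, uniq s, s =i facets K & shelling_order n s].

Definition face_number K (q : int) : nat :=
  #|[set F in K | #|F|%:Z == q + 1]|.

(* The summation index i is the cardinality q + 1 of the faces. *)
Definition reduced_euler K : int :=
  \sum_(i < #|X|.+1) (-1) ^ (i%:Z - 1) * (face_number K (i%:Z - 1))%:Z.

End Combinatorics.

Section Homology.
Variables (X : finType) (K : complex X).

(* Augmented oriented chain complex over int: the empty face has degree -1,
   and X is ordered by enum_rank. *)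
Definition face (q : int) := {F : {set X} | (F \in K) && (#|F|%:Z == q + 1)}.

Definition chain (q : int) := {ffun face q -> int}.

Definition position (F : {set X}) (v : X) : nat :=
  #|[set u in F | (enum_rank u < enum_rank v)%N]|.

(* The boundary operator, meant for p = q + 1; source and target degrees are
   independent parameters so that consecutive boundary maps compose without
   casts between the degrees q and q + 1 - 1. *)
Definition boundary (p q : int) (a : chain p) : chain q :=
  [ffun G : face q => \sum_(F : face p)
     \sum_(v in val F | val F :\ v == val G) (-1) ^+ position (val F) v * a F].

Lemma boundaryB p q : {morph @boundary p q : a b / a - b}.
Proof.
move=> a b; apply/ffunP => G; rewrite !ffunE -sumrB.
apply: eq_bigr => F _; rewrite -sumrB.
by apply: eq_bigr => v _; rewrite !ffunE mulrBr.
Qed.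

Definition cycles (q : int) : {pred chain q} :=
  [pred a | boundary (q - 1) a == 0].

Fact cycles_zmod_closed q : zmod_closed (@cycles q).
Proof.
have b0 : boundary (q - 1) (0 : chain q) = 0.
  by rewrite -[in LHS](subrr (0 : chain q)) boundaryB subrr.
split=> [|a b]; rewrite !inE ?b0// => /eqP a0 /eqP b0'.
by rewrite boundaryB a0 b0' subr0.
Qed.

HB.instance Definition _ q :=
  GRing.isZmodClosed.Build (chain q) (@cycles q) (@cycles_zmod_closed q).

Definition cycle_group (q : int) := {a : chain q | a \in @cycles q}.

HB.instance Definition _ q := SubChoice.on (cycle_group q).
HB.instance Definition _ q :=
  [SubChoice_isSubZmodule of cycle_group q by <:].

Definition boundaries (q : int) : {pred cycle_group q} :=
  [pred z | `[< exists b : chain (q + 1), boundary q b = val z >]].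

Fact boundaries_zmod_closed q : zmod_closed (@boundaries q).
Proof.
split=> [|a b]; rewrite !inE.
  exists 0.
  by rewrite -[in LHS](subrr (0 : chain (q + 1))) boundaryB subrr.
move=> [x xa] [y yb]; exists (x - y).
by rewrite boundaryB xa yb.
Qed.

HB.instance Definition _ q :=
  GRing.isZmodClosed.Build (cycle_group q) (@boundaries q)
    (@boundaries_zmod_closed q).

Definition reduced_homology (q : int) : zmodType :=
  Quotient.quot (@boundaries q : zmodClosed (cycle_group q)).

End Homology.

Definition zmod_isomorphic (A B : zmodType) : Prop :=
  exists f : {additive A -> B}, bijective f.

Local Open Scope classical_set_scope.

Section Topology.
Variable R : realType.

Definition homotopic (T U : topologicalType) (f g : T -> U) : Prop :=
  exists h : T * R -> U,
    [/\ {within [set: T] `*` `[0, 1], continuous h},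
        forall x, h (x, 0) = f x & forall x, h (x, 1) = g x].

Definition homotopy_equivalent (T U : topologicalType) : Prop :=
  exists (f : T -> U) (g : U -> T),
    [/\ continuous f, continuous g,
        homotopic (g \o f) id & homotopic (f \o g) id].

Definition contractible (T : topologicalType) : Prop :=
  exists x0 : T, homotopic id (fun _ : T => x0).

Definition realization_set (X : finType) (K : complex X) : set {ptws X -> R} :=
  [set t | [/\ forall x, 0 <= t x, \sum_(x : X) t x = 1
             & [set x | t x != 0]%SET \in faces K]].

(* set_type carries the subspace topology. *)
Definition realization (X : finType) (K : complex X) : topologicalType :=
  set_type (realization_set K).

Definition sphere_set (k : nat) : set {ptws 'I_k.+1 -> R} :=
  [set t | \sum_(i < k.+1) t i ^+ 2 = 1].
Arguments sphere_set : clear implicits.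

Definition sphere (k : nat) : topologicalType := set_type (sphere_set k).

Fact sphere_base_subproof (k : nat) :
  (fun i : 'I_k.+1 => (i == ord0)%:R : R) \in sphere_set k.
Proof.
rewrite inE /sphere_set /= (bigD1 ord0)//= expr1n big1 ?addr0// => i.
by move=> /negPf ->; rewrite expr0n.
Qed.

Definition sphere_base (k : nat) : sphere k :=
  exist (fun t => t \in sphere_set k) _ (sphere_base_subproof k).
Arguments sphere_base : clear implicits.

(* The library's wedge over an empty index type is empty, whence the separate
   case of a one-point space. *)
Definition wedge_of_spheres (t k : nat) : topologicalType :=
  if t is t'.+1 then wedge (fun _ : 'I_t'.+1 => sphere_base k)
  else set_type [set (0 : R)].

End Topology.

(* Main.v *)
From HB Require Import structures.
Require Import Defs.
From mathcomp Require Import all_boot all_order all_algebra.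
From mathcomp Require Import all_classical all_reals all_analysis.
From mathcomp Require Import homotopy zify ring.
Import Order.TTheory GRing.Theory Num.Theory.
Import numFieldNormedType.Exports.
Import mathcomp.boot.fintype mathcomp.boot.finset.

(** The faces of the dual are the sets whose complement contains a non-edge, so its
    facets are the complements of the non-edges.

    A chordal graph has a perfect elimination ordering, by Dirac's theorem
    ([chordal_simplicial_far], [chordal_elimination_order]). Listing the non-edges by
    their lower ends gives a shelling ([clique_dual_shellable]): if the non-edge [c, d]
    comes before [a, b] and its lower end [c] is not among [a, b], then [c] cannot be
    adjacent to both [a] and [b], later vertices that are not adjacent to each other;
    this produces an earlier non-edge with exactly one end in common with [a, b].

    The same ordering makes the dual collapse to the dual of the graph in which every
    component is completed to a clique ([clique_dual_collapses]). Each step removes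
    the open star of a face [sigma] whose link is a cone with some apex [p]. Such a step
    preserves the homotopy type, by moving mass from [sigma] to [p] ([push],
    [cone_equivalent]), the homology ([cone_push]) and the Euler characteristic
    ([euler_cone]). When [sigma] is empty the complex is a cone and becomes void; this
    happens when the graph is connected, and it proves contractibility.

    For a disjoint union of cliques, fix a vertex [y0] and a representative of each of
    the other cliques. The faces of the dual outside the star of [y0] split into one family
    for every other clique. Without the facets that are the complements of the
    pairs consisting of [y0] and a representative, the dual collapses to nothing
    ([noncritical_collapses]); adding these facets, one less than there are components,
    to an acyclic complex creates the homology ([spherical_basis_facets]).

    For the homotopy type, every other clique C gives a subcomplex of the dual, the join
    of the boundaries of the simplices on C and on its complement, which is
    homeomorphic to the sphere of dimension N - 3 ([join_sphere_homeo]). These spheres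
    have [y0] in common, and together they contain all faces outside the star of [y0].
    Crushing that star to [y0], by a homotopy that maps each sphere to itself ([slide]),
    identifies the dual with their wedge ([dual_wedge]). *)

Set Implicit Arguments.
Unset Strict Implicit.
Unset Printing Implicit Defensive.

Local Open Scope ring_scope.
Local Open Scope set_scope.

(** * Chordal graphs have perfect elimination orderings *)

Section ChordalGraphs.
Variables (X : finType) (e : rel X).
Hypotheses (e_sym : symmetric e) (e_irr : irreflexive e).
Implicit Types (S A B C : {set X}) (x y z u v w : X).

Lemma is_cliqueP A :
  reflect {in A &, forall x y, x != y -> e x y} (is_clique e A).
Proof.
apply: (iffP forall_inP) => [cA x y xA yA xy|cA x xA].
  by have /forall_inP/(_ _ yA)/implyP := cA _ xA; apply.
by apply/forall_inP => y yA; apply/implyP; exact: cA.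
Qed.

Definition restr (D : {set X}) : rel X :=
  [rel x y | [&& e x y, x \in D & y \in D]].

Lemma restrE D x y : restr D x y = [&& e x y, x \in D & y \in D].
Proof. by []. Qed.

(** A shortest path has no shortcut, hence is induced. *)
Lemma induced_path (r : rel X) x y : connect r x y ->
  exists p, [/\ path r x p, last x p = y, uniq (x :: p) &
    forall i j, (i < j <= size p)%N ->
      r (nth x (x :: p) i) (nth x (x :: p) j) -> j = i.+1].
Proof.
move=> rxy.
pose P n := `[< exists p, [/\ path r x p, last x p = y, uniq (x :: p)
                             & size p = n] >].
have exP : exists n, P n.
  have /connectP[p rp yE] := rxy; move: yE; have [q rq uq _ yE] := shortenP rp.
  by exists (size q); apply/asboolP; exists q.
case: (ex_minnP exP) => n /asboolP[p [rp lp up sp]] min_n.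
exists p; split=> // i j /andP[ij jp] rij; apply/eqP; rewrite eqn_leq ij andbT.
rewrite leqNgt; apply/negP => iltj.
have j0 : (0 < j)%N by apply: leq_ltn_trans ij.
(* The path with the vertices strictly between the i-th and the j-th cut out;
   positions in x :: p are shifted by one with respect to p. *)
pose q := take i p ++ drop j.-1 p.
have dj : drop j.-1 p = nth x p j.-1 :: drop j p.
  by rewrite (drop_nth x) ?prednK.
have li : last x (take i p) = nth x (x :: p) i.
  rewrite (last_nth x) size_takel; last by apply: ltnW (leq_trans ij jp).
  by case: (i) => [//|i'] /=; rewrite nth_take.
have qp : subseq q p.
  rewrite /q -[X in subseq _ X](cat_take_drop i p) cat_subseq ?subseq_refl//.
  have /subnK <- : (i <= j.-1)%N by rewrite -ltnS prednK.
  by rewrite -drop_drop drop_subseq.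
have /min_n : P (size q).
  apply/asboolP; exists q; split=> //.
  - rewrite cat_path take_path // li dj /=.
    have -> : r (nth x (x :: p) i) (nth x p j.-1).
      by have := rij; rewrite -{1}(prednK j0) /=.
    move: rp; rewrite -{1}(cat_take_drop j.-1 p) cat_path dj /=.
    by case/and3P.
  - rewrite last_cat dj /=.
    have : last x p = last x (take j.-1 p ++ drop j.-1 p) by rewrite cat_take_drop.
    by rewrite last_cat dj /= lp.
  - by apply: subseq_uniq up; rewrite /= eqxx.
rewrite -sp leqNgt size_cat size_takel ?size_drop; last first.
  by apply: ltnW (leq_trans ij jp).
by move/negP; apply; move: ij jp iltj j0; clear; lia.
Qed.

(** Two neighbours of [v] joined through vertices not adjacent to [v] close up,
    along an induced path, to a cycle in which they are the only possible
    chord. *)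
Lemma chordal_neighbours (C : {set X}) v x y : chordal e ->
  v \notin C -> {in C, forall z, ~~ e v z} -> e v x -> e v y -> x != y ->
  connect (restr (x |: (y |: C))) x y -> e x y.
Proof.
move=> ch vC Cv vx vy xy /induced_path[p [rp lp up ind]].
case exy : (e x y) => //.
set D := x |: (y |: C) in rp ind.
have vD : v \notin D.
  rewrite !inE !negb_or vC andbT; apply/andP; split; apply/eqP => vE.
    by rewrite vE e_irr in vx.
  by rewrite vE e_irr in vy.
have pD : {subset x :: p <= D}.
  move=> z; rewrite inE => /predU1P[->|]; first by rewrite !inE eqxx.
  elim: (p) (x) rp => [//|a q IH] b /= /andP[/and3P[_ _ aD] rq].
  by rewrite inE => /predU1P[->//|]; exact: IH rq.
have ep : path e x p by apply: sub_path rp => a b /and3P[].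
have vp : v \notin x :: p by apply/negP => /pD; rewrite (negPf vD).
have sz : (2 <= size p)%N.
  case: (p) lp ep => [/= lp|a [/= lp|//]]; first by rewrite lp eqxx in xy.
  by rewrite lp exy.
have uc : ucycle e (v :: x :: p).
  by rewrite /ucycle /= -cons_uniq cons_uniq vp up vx rcons_path ep lp e_sym vy.
have nextE z : z \in x :: p -> next (v :: x :: p) z
    = nth v (x :: p) (index z (x :: p)).+1.
  move=> zp; rewrite next_nth inE zp orbT /=.
  by case: eqP => // vz; rewrite vz zp in vp.
have [//|a [b [ain bin eab nb na]]] := ch _ _ uc.
(* No chord ends at v, whose only neighbours on the cycle are the consecutive
   vertices x and y. *)
have wl : forall a b, a \in v :: x :: p -> b \in v :: x :: p -> e a b ->
    b != next (v :: x :: p) a -> a != next (v :: x :: p) b -> a != v.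
  move=> {ain bin eab nb na}{}a {}b _ bs eab nb na; apply/eqP => av.
  move: eab nb na; rewrite {a}av.
  move: bs; rewrite inE => /predU1P[->|bp]; first by rewrite e_irr.
  have -> : next (v :: x :: p) v = x by rewrite next_nth inE eqxx /= eqxx.
  move=> vb; rewrite (nextE _ bp) => bx bv.
  have := pD _ bp; rewrite !inE => /or3P[/eqP bE|/eqP bE|/Cv]; last by rewrite vb.
    by rewrite bE eqxx in bx.
  move: bv; rewrite bE -lp.
  suff -> : index (last x p) (x :: p) = size p by rewrite nth_default ?eqxx.
  by rewrite (last_nth x) index_uniq //=.
have av := wl _ _ ain bin eab nb na.
have bv : b != v by apply: (wl b a) => //; rewrite e_sym.
have ap : a \in x :: p by move: ain; rewrite inE (negPf av).
have bp : b \in x :: p by move: bin; rewrite inE (negPf bv).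
clear wl ain bin.
(* Nor is there a chord between vertices of the induced path. *)
have key : forall a b, a \in x :: p -> b \in x :: p -> e a b ->
    (index a (x :: p) < index b (x :: p))%N -> b = next (v :: x :: p) a.
  move=> {eab nb na av bv ap bp}{}a {}b ap bp eab lab.
  have /ind : (index a (x :: p) < index b (x :: p) <= size p)%N.
    by rewrite lab /=; have := bp; rewrite -index_mem.
  rewrite nextE // !nth_index // /restr /= eab !pD // => /(_ isT) ibE.
  by rewrite -[RHS]/(nth v (x :: p) (index a (x :: p)).+1) -ibE nth_index.
have [lab|lab|iab] := ltngtP (index a (x :: p)) (index b (x :: p)).
- by rewrite -(key a b) ?eqxx in nb.
- by rewrite -(key b a) ?eqxx // e_sym in na.
have abE : a = b by rewrite -(nth_index x ap) iab nth_index.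
by rewrite abE e_irr in eab.
Qed.

Definition simplicial S v := is_clique e [set x in S | e v x].

(** Dirac's theorem, in the form suited to induction: given [v], take a
    component [C] of its non-neighbours; the boundary [B] of [C] is a clique by
    [chordal_neighbours], so a simplicial vertex of the smaller graph [B :|: C]
    can be found in [C], where no neighbour is lost. *)
Lemma chordal_simplicial_far S v w : chordal e -> v \in S -> w \in S -> w != v ->
  ~~ e v w -> exists2 u, u \in S & [/\ u != v, ~~ e v u & simplicial S u].
Proof.
move=> ch; move: {2}(#|S|) (leqnn #|S|) => n.
elim: n S v w => [|n IH] S v w.
  by rewrite leqn0 => /eqP/cards0_eq ->; rewrite inE.
move=> Sn vS wS wv evw.
pose T := [set z in S | (z != v) && ~~ e v z].
pose C := [set z | connect (restr T) w z].
have wT : w \in T by rewrite inE wS wv.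
have CT z : z \in C -> z \in T.
  rewrite inE => /connectP[p]; elim/last_ind: p z => [|p a _] z; first by move=> _ ->.
  by rewrite rcons_path last_rcons => /andP[_ /and3P[_ _ ?]] ->.
have CS z : z \in C -> z \in S by move/CT; rewrite inE => /andP[].
have CC z z' : z \in C -> z' \in T -> e z z' -> z' \in C.
  move=> zC z'T ezz'; have := zC; rewrite !inE => /connect_trans; apply.
  by apply: connect1; rewrite restrE ezz' CT.
have vC : v \notin C by apply/negP => /CT; rewrite !inE eqxx andbF.
have Cv : {in C, forall z, ~~ e v z} by move=> z /CT; rewrite !inE => /and3P[].
pose B := [set b in S | e v b & [exists z in C, e b z]].
pose U := B :|: C.
have connC (D : {set X}) z z' : C \subset D -> z \in C -> z' \in C -> connect (restr D) z z'.
  move=> /subsetP CD.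
  have wc y : y \in C -> connect (restr D) w y.
    rewrite inE => /connectP[p]; elim/last_ind: p y => [|p a IHp] y.
      by move=> _ ->; exact: connect0.
    rewrite rcons_path last_rcons => /andP[rp ra] ->.
    apply: connect_trans (IHp _ rp erefl) _; apply: connect1.
    have lC : last w p \in C by rewrite inE; apply/connectP; exists p.
    have /and3P[ela _ aT] := ra.
    by rewrite restrE ela !CD //; exact: CC lC aT ela.
  have scD : connect_sym (restr D).
    by apply: sym_connect_sym => a b; rewrite !restrE e_sym; congr (_ && _); rewrite andbC.
  by move=> /wc; rewrite scD => zw /wc; exact: connect_trans.
have Bclique : {in B &, forall x y, x != y -> e x y}.
  move=> x y; rewrite !inE => /and3P[xS vx /exists_inP[z zC xz]].
  move=> /and3P[yS vy /exists_inP[z' z'C yz']] xy.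
  apply: (chordal_neighbours ch vC Cv vx vy xy).
  set D := x |: (y |: C); have CD : C \subset D.
    by apply/subsetP => a aC; rewrite !in_setU1 aC !orbT.
  apply: connect_trans (connect_trans (connC D _ _ CD zC z'C) _); apply: connect1.
    by rewrite restrE xz !in_setU1 eqxx zC !orbT.
  by rewrite restrE e_sym yz' !in_setU1 eqxx z'C !orbT.
have US : U \subset S.
  apply/subsetP => z; rewrite in_setU => /orP[|/CS//].
  by rewrite inE => /and3P[].
have vU : v \notin U.
  rewrite in_setU negb_or vC andbT; apply/negP.
  by rewrite inE e_irr andbF.
have Un : (#|U| <= n)%N.
  rewrite -ltnS; apply: leq_trans Sn; apply: proper_card.
  by rewrite properE US; apply/subsetPn; exists v.
have NU z b : z \in C -> b \in S -> e z b -> b \in U.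
  move=> zC bS zb; rewrite in_setU; case vb : (e v b).
    by rewrite inE bS vb /=; apply/orP; left; apply/exists_inP; exists z; rewrite // e_sym.
  apply/orP; right; apply: (CC _ _ zC _ zb); rewrite inE bS vb andbT.
  by apply: contraTneq zb => ->; rewrite e_sym Cv.
(* A vertex of C keeps all its neighbours when S is cut down to U. *)
suff [s sC simp] : exists2 s, s \in C & simplicial U s.
  exists s; first exact: CS.
  have := CT _ sC; rewrite inE => /and3P[_ -> ->]; split=> //.
  have -> // : simplicial S s = simplicial U s.
  rewrite /simplicial; congr is_clique; apply/setP => b; rewrite !inE.
  case sb : (e s b); rewrite ?andbF // !andbT; apply/idP/idP => [bS|].
    by have := NU _ _ sC bS sb; rewrite !inE.
  by move=> bU; apply: (subsetP US); rewrite !inE.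
(* To force the simplicial vertex of U into C, start the induction from a vertex
   whose non-neighbours in U are all in C: one in the clique B if it is not
   adjacent to all of U, and otherwise any vertex of C. *)
have [/exists_inP[u uB /exists_inP[u' u'U /andP[u'u uu']]]|Buniv] :=
    boolP [exists u in B, [exists u' in U, (u' != u) && ~~ e u u']].
  have uU : u \in U by rewrite in_setU uB.
  have [s sU [su eus simp]] := IH U u u' Un uU u'U u'u uu'.
  exists s => //; move: sU; rewrite in_setU => /orP[sB|//].
  by rewrite (Bclique u s) // eq_sym in eus.
have Bu b u : b \in B -> u \in U -> u != b -> e b u.
  move=> bB uU ub; apply: contraNT Buniv => nbu.
  by apply/exists_inP; exists b => //; apply/exists_inP; exists u => //; rewrite ub.
have [/exists_inP[u uC /exists_inP[u' u'U /andP[u'u uu']]]|Cuniv] :=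
    boolP [exists u in C, [exists u' in U, (u' != u) && ~~ e u u']].
  have uU : u \in U by rewrite in_setU uC orbT.
  have [s sU [su eus simp]] := IH U u u' Un uU u'U u'u uu'.
  exists s => //; move: sU; rewrite in_setU => /orP[sB|//].
  by rewrite e_sym (Bu s u) // eq_sym in eus.
exists w; first by rewrite inE connect0.
apply/is_cliqueP => a b; rewrite inE => /andP[aU _]; rewrite inE => /andP[bU _] ab.
move: (aU); rewrite in_setU => /orP[aB|aC]; first by apply: Bu; rewrite // eq_sym.
apply: contraNT Cuniv => nab.
by apply/exists_inP; exists a => //; apply/exists_inP; exists b => //; rewrite eq_sym ab.
Qed.

(** The perfect elimination orderings of graph theory. Vertices that do not occur
    in [s] have index [size s] and are excluded by the upper bounds. *)
Definition elimination_order (s : seq X) :=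
  forall u x y, (index u s < index x s < size s)%N ->
    (index u s < index y s < size s)%N -> e u x -> e u y -> x != y -> e x y.

Lemma chordal_elimination_order S : chordal e ->
  exists s, [/\ uniq s, s =i S & elimination_order s].
Proof.
move=> ch; move: {2}(#|S|) (leqnn #|S|) => n.
elim: n S => [|n IH] S.
  by rewrite leqn0 => /eqP/cards0_eq ->; exists [::]; split=> // z; rewrite inE.
move=> Sn; have [->|/set0Pn[v0 v0S]] := eqVneq S set0.
  by exists [::]; split=> // z; rewrite inE.
have [v vS simp] : exists2 v, v \in S & simplicial S v.
  have [/exists_inP[w wS /andP[wv vw]]|univ] :=
      boolP [exists w in S, (w != v0) && ~~ e v0 w].
    by have [u uS []] := chordal_simplicial_far ch v0S wS wv vw; exists u.
  have [/exists_inP[u uS /exists_inP[w wS /andP[wu uw]]]|Suniv] :=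
      boolP [exists u in S, [exists w in S, (w != u) && ~~ e u w]].
    by have [u' uS' []] := chordal_simplicial_far ch uS wS wu uw; exists u'.
  exists v0 => //; apply/is_cliqueP => a b; rewrite !inE => /andP[aS _] /andP[bS _] ab.
  apply: contraNT Suniv => nab; apply/exists_inP; exists a => //.
  by apply/exists_inP; exists b => //; rewrite eq_sym ab.
have [|s [us sE so]] := IH (S :\ v).
  by move: Sn; rewrite (cardsD1 v S) vS.
exists (v :: s); split.
- by rewrite /= sE !inE eqxx.
- by move=> z; rewrite inE sE !inE; case: eqVneq => [->|].
move=> u x y /=; have [<-|vu] := eqVneq v u.
  case: eqVneq => // vx; case: eqVneq => // vy; rewrite !ltnS !leq0n /=.
  rewrite !index_mem !sE !inE => /andP[_ xS] /andP[_ yS] ux uy xy.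
  by move/is_cliqueP: simp; apply; rewrite // inE ?xS ?yS.
case: eqVneq => // vx; case: eqVneq => // vy; rewrite !ltnS.
exact: so.
Qed.

End ChordalGraphs.
(** * Collapses along stars with a conical link *)

Section Collapses.
Variable X : finType.
Implicit Types (K L : complex X) (F G : {set X}) (p : X).

Lemma complex_eq K L : faces K = faces L -> K = L.
Proof.
case: K L => [K cK] [L cL] /= KL.
by case: L / KL cL => cL; rewrite (Prop_irrelevance cK cL).
Qed.

Lemma delete_star_closed K (sigma : {set X}) F G :
  F \in [set F in K | ~~ (sigma \subset F)] -> G \subset F ->
  G \in [set F in K | ~~ (sigma \subset F)].
Proof.
rewrite !inE => /andP[FK nF] GF; rewrite (faces_closed FK) //=.
by apply: contra nF => /subset_trans; apply.
Qed.

Definition delete_star K sigma : complex X :=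
  Complex (@delete_star_closed K sigma).

Lemma in_delete_star K sigma F :
  (F \in delete_star K sigma) = (F \in K) && ~~ (sigma \subset F).
Proof. by rewrite inE. Qed.

(** The cone condition on the link of [sigma] is expressed on the star, so that it
    makes sense when [sigma] is empty; [K] itself is then a cone. *)
Definition cone_link K (sigma : {set X}) p : Prop :=
  p \notin sigma /\ forall F, F \in K -> sigma \subset F -> p |: F \in K.

(** Removing the open star of a face whose link is a cone is a composite of
    elementary collapses. The face may be empty: then the whole complex is a
    cone and what remains is void. *)
Inductive collapses : complex X -> complex X -> Prop :=
| collapses_refl K : collapses K K
| collapses_cone K L sigma p : cone_link K sigma p ->
    collapses (delete_star K sigma) L -> collapses K L.

Lemma collapses_trans K L M : collapses K L -> collapses L M -> collapses K M.
Proof.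
by elim=> // {}K {}L sigma p cK _ IH /IH; apply: collapses_cone cK.
Qed.

Lemma collapses_step K L sigma p :
  collapses K L -> cone_link L sigma p -> collapses K (delete_star L sigma).
Proof.
move=> KL cL; apply: collapses_trans KL _.
by apply: collapses_cone cL _; exact: collapses_refl.
Qed.

Definition delete_stars K (sigma : X -> {set X}) (s : seq X) : complex X :=
  foldr (fun v L => delete_star L (sigma v)) K s.

Lemma in_delete_stars K (sigma : X -> {set X}) s F : (F \in delete_stars K sigma s) =
  (F \in K) && all (fun v => ~~ (sigma v \subset F)) s.
Proof.
elim: s => [|v s IH] /=; first by rewrite andbT.
by rewrite in_delete_star IH -andbA [X in _ && X]andbC.
Qed.

Lemma void_closed F G : F \in (set0 : {set {set X}}) -> G \subset F ->
  G \in (set0 : {set {set X}}).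
Proof. by rewrite inE. Qed.

Definition void_complex : complex X := Complex void_closed.

Lemma delete_star0 K : delete_star K set0 = void_complex.
Proof.
by apply: complex_eq; apply/setP => F; rewrite in_delete_star sub0set andbF inE.
Qed.

End Collapses.
Arguments void_complex {X}.

(** * The dual of a chordal graph collapses to that of its components *)

Definition clique_dual (X : finType) (r : rel X) : complex X :=
  alexander_dual (clique_complex r).

Lemma in_clique_dual (X : finType) (r : rel X) F :
  (F \in clique_dual r) = ~~ is_clique r (~: F).
Proof. by rewrite !inE. Qed.

Lemma not_cliqueP (X : finType) (r : rel X) (A : {set X}) :
  reflect (exists x y, [/\ x \in A, y \in A, x != y & ~~ r x y]) (~~ is_clique r A).
Proof.
apply: (iffP idP) => [|[x [y [xA yA xy rxy]]]]; last first.
  by apply: contra rxy => /is_cliqueP/(_ x y xA yA xy).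
rewrite negb_forall => /existsP[x]; rewrite negb_imply => /andP[xA].
rewrite negb_forall => /existsP[y]; rewrite negb_imply => /andP[yA].
by rewrite negb_imply => /andP[xy rxy]; exists x, y.
Qed.

(** A face of the dual misses a non-edge, so it cannot properly contain the
    complement of a pair. *)
Lemma clique_dual_facet (X : finType) (r : rel X) a b F : F \in clique_dual r ->
  ~: [set a; b] \subset F -> F = ~: [set a; b].
Proof.
rewrite in_clique_dual => nF rF; apply/eqP; rewrite eq_sym eqEsubset rF /=.
have sF : ~: F \subset [set a; b] by rewrite -setCS setCK.
have /not_cliqueP[x [y [xF yF xy _]]] := nF.
rewrite -setCS setCK; apply/subsetP => z; rewrite !inE.
have := subsetP sF x xF; have := subsetP sF y yF; move: xF yF; rewrite !inE.
move=> xF yF /orP[]/eqP yE /orP[]/eqP xE; subst x y; rewrite ?eqxx // in xy *;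
  by case/orP => /eqP ->.
Qed.

Section DualCollapse.
Variables (X : finType) (e : rel X) (s : seq X).
Hypotheses (e_sym : symmetric e) (e_irr : irreflexive e).
Hypotheses (s_uniq : uniq s) (s_all : forall x, x \in s).
Hypothesis s_elim : elimination_order e s.
Implicit Types (F Q : {set X}) (u v w x y : X).

Let rank x := index x s.

Lemma rank_inj : injective rank.
Proof. by move=> x y; apply: index_inj. Qed.

Lemma later_clique u x y : (rank u < rank x)%N -> (rank u < rank y)%N ->
  e u x -> e u y -> x != y -> e x y.
Proof. by move=> ux uy; apply: s_elim; rewrite index_mem s_all andbT. Qed.

(** Deleting the vertices of low rank one by one does not disconnect the
    others: a path through the lowest vertex [u] can bypass it, because the
    neighbours of [u] are adjacent to one another. *)
Lemma connect_upper m x y : connect e x y -> (m <= rank x)%N -> (m <= rank y)%N ->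
  connect (restr e [set z | m <= rank z]%N) x y.
Proof.
move=> exy; elim: m => [_ _|m IH xm ym].
  have /eq_connect -> // : restr e [set z | 0 <= rank z]%N =2 e.
  by move=> a b; rewrite restrE !inE !andbT.
have := IH (ltnW xm) (ltnW ym).
set r := restr e _; set r' := restr e _.
(* phi moves the vertex of rank m to one of its later neighbours. *)
pose phi z := if rank z == m then odflt z [pick n | e z n && (m < rank n)%N]
              else z.
have phiE z : (m < rank z)%N -> phi z = z.
  by rewrite /phi; case: eqP => // ->; rewrite ltnn.
have phim z n : rank z = m -> e z n -> (m < rank n)%N ->
    connect r' (phi z) n /\ connect r' n (phi z).
  move=> zm zn mn; rewrite /phi zm eqxx; case: pickP => [n'|/(_ n)]; last first.
    by rewrite zn mn.
  case/andP=> zn' mn' /=; have [->|nn'] := eqVneq n' n; first by rewrite connect0.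
  have en : e n' n by apply: (@later_clique z); rewrite ?zm.
  by split; apply: connect1; rewrite /r' restrE ?[e n n']e_sym en !inE mn mn'.
have step a b : r a b -> connect r' (phi a) (phi b).
  rewrite /r restrE !inE => /and3P[ab ma mb].
  move: ma mb; rewrite leq_eqVlt => /predU1P[ma|ma]; rewrite leq_eqVlt => /predU1P[mb|mb].
  - have aE : a = b by apply: rank_inj; rewrite -ma.
    by rewrite aE e_irr in ab.
  - by rewrite (phiE b mb); have [] := phim a b (esym ma) ab mb.
  - by rewrite (phiE a ma); rewrite e_sym in ab; have [] := phim b a (esym mb) ab ma.
  - by rewrite !phiE //; apply: connect1; rewrite /r' restrE ab !inE ma mb.
move=> /connectP[p rp yE]; rewrite -(phiE x xm) -(phiE y ym) {ym exy}yE.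
elim: p x rp {IH xm} => [|a p IHp] x /=; first by rewrite connect0.
by case/andP => /step xa /IHp; exact: connect_trans.
Qed.

(** By [connect_upper] a path from [v] to [w] can be chosen above [v]; its second
    vertex is the neighbour sought. *)
Lemma later_neighbour v w : connect e v w -> (rank v < rank w)%N ->
  exists2 n, e v n & (rank v < rank n)%N.
Proof.
move=> vw lvw; have /connectP[[|n p]] := connect_upper vw (leqnn _) (ltnW lvw).
  by move=> _ wE; rewrite wE ltnn in lvw.
rewrite /= restrE !inE => /andP[/and3P[vn _ ln] _] _; exists n => //.
rewrite ltn_neqAle ln andbT; apply: contraTneq vn => /rank_inj ->.
by rewrite e_irr.
Qed.

Definition later v := [set w | connect e v w & (rank v < rank w)%N].

Let sigma v := ~: (v |: later v).

Let connect_e_sym : connect_sym e.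
Proof. exact: sym_connect_sym. Qed.

(** The complement of [F] lies in one component; its lowest vertex [u] sees the
    rest of it among the later vertices. *)
Lemma lowest_sigma F v x : x \notin F -> {in ~: F, forall y, connect e v y} ->
  exists2 u, u \notin F & sigma u \subset F.
Proof.
move=> xF cF; have xQ : x \in ~: F by rewrite inE.
have [u uQ u_min] := @arg_minnP _ x (mem (~: F)) rank xQ.
exists u; first by move: uQ => /=; rewrite inE.
rewrite /sigma -setCS setCK; apply/subsetP => y yQ; rewrite !inE.
have [//|yu] := eqVneq y u; rewrite ltn_neqAle u_min // andbT.
rewrite (inj_eq rank_inj) eq_sym yu andbT.
by apply: connect_trans (cF _ yQ); rewrite connect_e_sym cF.
Qed.

(** Vertices [v] are treated from the highest rank down. The faces containing
    [sigma v] still present are the complements of [v |: K] with [K] a set of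
    later vertices of its component not all adjacent to [v]; any later
    neighbour of [v] may be added to or dropped from [K]. *)
Lemma clique_dual_collapses : collapses (clique_dual e) (clique_dual (connect e)).
Proof.
have -> : clique_dual (connect e) = delete_stars (clique_dual e) sigma s.
  apply/complex_eq/setP => F; rewrite in_delete_stars !in_clique_dual.
  apply/idP/andP => [/not_cliqueP[x [y [xF yF xy cxy]]]|[nF /allP all_s]].
    split; first by apply/not_cliqueP; exists x, y; split=> //; apply: contra cxy => /connect1.
    apply/allP => v _; apply: contra cxy => /subsetP vF.
    have vc z : z \in ~: F -> connect e v z.
      rewrite inE => zF; have := contra (vF z) zF; rewrite !inE negbK.
      by case/predU1P => [->|/andP[]].
    by apply: connect_trans (vc y yF); rewrite connect_e_sym vc.
  apply/negP => /is_cliqueP cF.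
  have /not_cliqueP[x [_ [xF _ _ _]]] := nF.
  have xF' : x \notin F by rewrite inE in xF.
  have [y yF|u uF] := @lowest_sigma F x x xF'; last by rewrite (negPf (all_s _ (s_all u))).
  by have [->|xy] := eqVneq x y; [exact: connect0|apply: cF].
suff: forall s2 s1, s = s1 ++ s2 ->
    collapses (clique_dual e) (delete_stars (clique_dual e) sigma s2).
  by apply; exact: (erefl ([::] ++ s)).
elim=> [|v s2 IH] s1 sE; first exact: collapses_refl.
(* The vertices already treated are those of higher rank. *)
have s2P u : (u \in s2) = (rank v < rank u)%N.
  have := s_uniq; rewrite /rank sE cat_uniq => /and3P[_ /hasPn dj /= /andP[vs2 us2]].
  have vs1 : v \notin s1 by apply: dj; rewrite inE eqxx.
  have rv : index v (s1 ++ v :: s2) = size s1.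
    by rewrite index_cat (negPf vs1) /= eqxx addn0.
  rewrite rv; have := s_all u; rewrite sE mem_cat inE => /or3P[us1|/eqP ->|us2'].
  - rewrite index_cat us1 ltnNge ltnW ?index_mem //.
    by apply/negP => us2'; have := dj u; rewrite inE us2' orbT us1 => /(_ isT).
  - by rewrite rv ltnn (negPf vs2).
  - have us1 : u \notin s1 by apply: dj; rewrite inE us2' orbT.
    rewrite us2' index_cat (negPf us1) /=; case: eqP => [vu|_].
      by rewrite vu us2' in vs2.
    by rewrite addnS ltnS leq_addr.
pose n := odflt v [pick n | e v n && (rank v < rank n)%N].
have nP w : connect e v w -> (rank v < rank w)%N -> e v n /\ (rank v < rank n)%N.
  move=> vw lvw; have [n' vn' ln'] := later_neighbour vw lvw.
  by rewrite /n; case: pickP => [? /andP[]//|/(_ n')]; rewrite vn' ln'.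
rewrite /=; apply: (@collapses_step _ _ _ _ n).
  by apply: (IH (rcons s1 v)); rewrite cat_rcons.
split.
  rewrite /sigma !inE negbK /n; case: pickP => [n' /andP[vn' ln']|] /=; last by rewrite eqxx.
  by rewrite connect1 // ln' orbT.
move=> F; rewrite !in_delete_stars !in_clique_dual => /andP[nF /allP all_s] vF.
have QF z : z \notin F -> (z == v) || (z \in later v).
  by move=> zF; have := contra (subsetP vF z) zF; rewrite in_setC negbK in_setU1.
(* If v were in F, the lowest vertex outside F would already have been treated. *)
have vnF : v \notin F.
  apply/negP => vF'; have /not_cliqueP[x [_ [xF _ _ _]]] := nF.
  have later_x z : z \notin F -> z \in later v.
    by move=> zF; case/orP: (QF z zF) => // /eqP zv; rewrite zv vF' in zF.
  have xF' : x \notin F by rewrite inE in xF.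
  have [z|u uF] := @lowest_sigma F v x xF'.
    by rewrite inE => /later_x; rewrite inE => /andP[].
  apply/negP; apply: all_s; rewrite s2P.
  by have := later_x u uF; rewrite inE => /andP[].
(* Were v adjacent to all vertices outside F, these would form a clique. *)
have [w wF /andP[wv vw]] : exists2 w, w \notin F & (w != v) && ~~ e v w.
  apply/exists_inP; apply: contraNT nF; rewrite negb_exists => /forallP nw.
  have vn z : z \notin F -> z != v -> e v z /\ (rank v < rank z)%N.
    move=> zF zv; have := nw z; rewrite zF zv /= negbK => vz; split=> //.
    by have := QF z zF; rewrite (negPf zv) inE => /andP[].
  apply/is_cliqueP => x y; rewrite !inE => xF yF xy.
  have [xv|xv] := eqVneq x v.
    by rewrite xv; have [] := vn y yF; rewrite // -xv eq_sym.
  have [yv|yv] := eqVneq y v.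
    by rewrite yv e_sym; have [] := vn x xF.
  have [[vx lx] [vy ly]] := (vn x xF xv, vn y yF yv).
  exact: (@later_clique v).
have /andP[cvw lvw] : connect e v w && (rank v < rank w)%N.
  by have := QF w wF; rewrite (negPf wv) inE.
have [vn ln] := nP w cvw lvw.
have vnn : v != n by apply: contraTneq vn => <-; rewrite e_irr.
apply/andP; split.
  apply/not_cliqueP; exists v, w; split=> //; last by rewrite eq_sym.
    by rewrite !inE negb_or vnn.
  by rewrite !inE negb_or wF andbT; apply: contraNneq vw => ->.
apply/allP => u; rewrite s2P => lu; apply/subsetPn; exists v; last first.
  by rewrite !inE negb_or vnn.
rewrite !inE negb_or negb_and -leqNgt (ltnW lu) orbT andbT.
by apply: contraTneq lu => ->; rewrite ltnn.
Qed.

End DualCollapse.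

(** * The dual of a disjoint union of cliques *)

(** The cliques are the classes of [c], and [R] represents those other than the
    class of [y0]. *)
Section ClusterDual.
Variables (X : finType) (c : rel X) (y0 : X) (R : {set X}).
Hypotheses (c_refl : reflexive c) (c_sym : symmetric c) (c_trans : transitive c).
Hypothesis R_far : {in R, forall r, ~~ c y0 r}.
Hypothesis R_inj : {in R &, forall r r', c r r' -> r = r'}.
Hypothesis R_cover : forall x, ~~ c y0 x -> exists2 r, r \in R & c r x.
Implicit Types (F Q : {set X}) (r x : X).

Definition critical_face r := ~: [set y0; r].

Definition critical_faces := [set critical_face r | r in R].

Lemma noncritical_closed (F G : {set X}) :
  F \in [set F in clique_dual c | F \notin critical_faces] -> G \subset F ->
  G \in [set F in clique_dual c | F \notin critical_faces].
Proof.
rewrite in_set => /andP[FD FT] GF; rewrite in_set (faces_closed FD GF) /=.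
apply: contra FT => /imsetP[r rR GE]; apply/imsetP; exists r => //.
by apply: clique_dual_facet FD _; rewrite -/(critical_face r) -GE.
Qed.

Definition noncritical_complex : complex X := Complex noncritical_closed.

Lemma in_noncritical F : (F \in noncritical_complex) =
  (F \in clique_dual c) && (F \notin critical_faces).
Proof. by rewrite in_set. Qed.

(** A face of the dual lies outside the star of [y0] exactly when it contains one
    of these sets: see [opposite_face] and [star_or_opposite]. *)
Definition opposite r := ~: (y0 |: [set x | c r x]).

Let y0R r : r \in R -> y0 != r.
Proof. by move=> rR; apply: contraTneq (R_far rR) => <-; rewrite c_refl. Qed.

Lemma in_opposite r x : (x \in opposite r) = (x != y0) && ~~ c r x.
Proof. by rewrite !inE negb_or. Qed.

Lemma opposite_face r F : F \in clique_dual c -> opposite r \subset F ->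
  y0 \notin F /\ exists2 x, x \notin F & c r x.
Proof.
rewrite in_clique_dual => nF rF.
have QF z : z \notin F -> (z == y0) || c r z.
  by move=> zF; have := contra (subsetP rF z) zF; rewrite in_opposite negb_and !negbK.
have y0F : y0 \notin F.
  apply/negP => y0F; have /not_cliqueP[x [y [xF yF _]]] := nF.
  have rz z : z \in ~: F -> c r z.
    by rewrite inE => zF; case/orP: (QF z zF) => // /eqP zE; rewrite zE y0F in zF.
  by rewrite (@c_trans r) ?rz // c_sym rz.
split=> //; apply/exists_inP; apply: contraNT nF; rewrite negb_exists => /forallP nx.
have zy0 z : z \notin F -> z = y0.
  by move=> zF; have := nx z; rewrite zF /=; have := QF z zF; case/orP=> [/eqP|->].
by apply/is_cliqueP => x y; rewrite !inE => /zy0 -> /zy0 ->; rewrite eqxx.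
Qed.

(** If [y0] cannot be added to [F], the complement of [F] less [y0] is a clique
    that [y0] does not extend: it lies in one of the other classes. *)
Lemma star_or_opposite F : F \in clique_dual c -> y0 |: F \notin clique_dual c ->
  exists2 r, r \in R & opposite r \subset F.
Proof.
rewrite !in_clique_dual negbK => nF /is_cliqueP cF.
have /not_cliqueP[x [y [xF yF xy cxy]]] := nF.
have cF' a b : a \notin F -> b \notin F -> a != y0 -> b != y0 -> c a b.
  move=> aF bF ay by0; have [->|ab] := eqVneq a b; first exact: c_refl.
  by apply: cF; rewrite // !inE negb_or ?ay ?by0.
rewrite !inE in xF yF.
have [z zF zy] : exists2 z, z \notin F & ~~ c y0 z.
  have [xE|x0] := eqVneq x y0; first by exists y => //; rewrite -xE.
  have [yE|y0'] := eqVneq y y0; first by exists x => //; rewrite -yE c_sym.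
  by rewrite (cF' x y) in cxy.
have zy0 : z != y0 by apply: contraNneq zy => ->; rewrite c_refl.
have [r rR rz] := R_cover zy; exists r => //.
rewrite -setCS setCK; apply/subsetP => a; rewrite !inE => aF.
have [//|ay] := eqVneq a y0; by apply: c_trans rz _; apply: cF'.
Qed.

(** Off the critical facets, a face either admits [y0] or is the complement of
    [y0 |: K] with [K] inside one class; in the second case the representative
    of that class can be added or dropped. *)
Lemma noncritical_collapses : collapses noncritical_complex void_complex.
Proof.
pose L s := delete_stars noncritical_complex opposite s.
have LR : collapses noncritical_complex (L (enum R)).
  have: uniq (enum R) /\ {subset enum R <= R} by rewrite enum_uniq; split=> // x; rewrite mem_enum.
  elim: (enum R) => [_|r s IH]; first exact: collapses_refl.
  rewrite /= => -[/andP[rs us] sR]; apply: (@collapses_step _ _ _ _ r).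
    by apply: IH; split=> // x xs; apply: sR; rewrite inE xs orbT.
  have rR : r \in R by apply: sR; rewrite inE eqxx.
  split; first by rewrite in_opposite c_refl andbF.
  move=> F; rewrite !in_delete_stars !in_noncritical.
  move=> /andP[/andP[FD FT] /allP all_s] rF.
  have [y0F _] := opposite_face FD rF.
  have QF z : z \notin F -> (z == y0) || c r z.
    by move=> zF; have := contra (subsetP rF z) zF; rewrite in_opposite negb_and !negbK.
  (* Otherwise F would be the critical face of r. *)
  have [x xF /andP[xr rx]] : exists2 x, x \notin F & (x != r) && c r x.
    apply/exists_inP; apply: contraNT FT; rewrite negb_exists => /forallP nx.
    apply/imsetP; exists r => //; apply: (clique_dual_facet FD).
    rewrite -setCS setCK; apply/subsetP => z; rewrite !inE => zF.
    have := nx z; rewrite zF /= negb_and negbK; have := QF z zF.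
    by case/orP => -> //; rewrite orbF => ->; rewrite orbT.
  have xy0 : ~~ c y0 x by apply: contra (R_far rR) => /c_trans; apply; rewrite c_sym.
  have xy0' : x != y0 by apply: contraNneq xy0 => ->; rewrite c_refl.
  apply/andP; split; first (apply/andP; split).
  - rewrite in_clique_dual; apply/not_cliqueP; exists y0, x.
    by rewrite !inE !negb_or y0F xF xr y0R // eq_sym xy0'.
  - apply/imsetP => -[r' r'R rE]; have := congr1 (fun A : {set X} => r' \in A) rE.
    rewrite !inE eqxx orbT /= => /negbT; rewrite negb_or => /andP[r'r r'F].
    have := QF r' r'F; rewrite eq_sym (negPf (y0R r'R)) /= => rr'.
    by rewrite (R_inj rR r'R rr') eqxx in r'r.
  apply/allP => u us'; apply/subsetPn; exists x; last by rewrite !inE negb_or xr.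
  rewrite in_opposite xy0' /=; apply: contra rs => ux.
  have uR : u \in R by apply: sR; rewrite inE us' orbT.
  by rewrite (R_inj rR uR) // (c_trans rx) // c_sym.
(* What remains is the star of y0. *)
rewrite -(delete_star0 (L (enum R))).
apply: (@collapses_step _ _ _ _ y0) => //; split; first by rewrite inE.
move=> F; rewrite !in_delete_stars !in_noncritical.
move=> /andP[/andP[FD _] /allP all_R] _; apply/andP; split; first (apply/andP; split).
- apply/negPn/negP => /(star_or_opposite FD)[r rR rF].
  by rewrite -mem_enum in rR; rewrite (negPf (all_R r rR)) in rF.
- apply/imsetP => -[r rR rE]; have := congr1 (fun A : {set X} => y0 \in A) rE.
  by rewrite !inE !eqxx.
- apply/allP => r /all_R; apply: contra => /subsetP rF; apply/subsetP => x xr.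
  have := rF x xr; rewrite in_setU1 => /orP[/eqP xE|//].
  by move: xr; rewrite in_opposite xE eqxx.
Qed.

End ClusterDual.
(** * Shellability *)

Section DualShelling.
Variables (X : finType) (e : rel X) (s : seq X).
Hypotheses (e_sym : symmetric e) (s_uniq : uniq s) (s_all : forall x, x \in s).
Hypothesis s_elim : elimination_order e s.
Implicit Types (F : {set X}) (a b x y : X).

Lemma facets_clique_dualP F :
  reflect (exists a b, [/\ a != b, ~~ e a b & F = ~: [set a; b]])
          (F \in facets (clique_dual e)).
Proof.
rewrite in_set; apply: (iffP andP) => [[FD /forall_inP Fmax]|[a [b [ab nab ->]]]].
  have := FD; rewrite in_clique_dual => /not_cliqueP[a [b [aF bF ab nab]]].
  exists a, b; split=> //; apply/eqP; rewrite eq_sym.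
  have GD : ~: [set a; b] \in clique_dual e.
    by rewrite in_clique_dual setCK; apply/not_cliqueP; exists a, b; rewrite !inE !eqxx orbT.
  apply: (implyP (Fmax _ GD)); rewrite -setCS setCK; apply/subsetP => z; rewrite !inE.
  by case/orP => /eqP ->; rewrite -in_setC.
split.
  by rewrite in_clique_dual setCK; apply/not_cliqueP; exists a, b; rewrite !inE !eqxx orbT.
apply/forall_inP => G GD; apply/implyP => sG; apply/eqP.
exact: clique_dual_facet GD sG.
Qed.

Lemma card_clique_dual_facet F : F \in facets (clique_dual e) -> #|F| = (#|X| - 2)%N.
Proof. by move=> /facets_clique_dualP[a [b [ab _ ->]]]; rewrite cardsCs setCK cards2 ab. Qed.

(** As [s] lists the vertices by rank, this is the rank of the lower end of the
    non-edge that a facet [F] omits. *)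
Definition lowest F := find (fun x => x \notin F) s.

Lemma lowest_le F x : x \notin F -> (lowest F <= index x s)%N.
Proof.
move=> xF; rewrite leqNgt; apply/negP => /(before_find x).
by rewrite nth_index ?s_all // xF.
Qed.

Lemma lowestP F x : x \notin F -> exists2 y, y \notin F & lowest F = index y s.
Proof.
move=> xF; have hF : has (fun x => x \notin F) s by apply/hasP; exists x.
exists (nth x s (lowest F)); last by rewrite index_uniq // -has_find.
exact: (nth_find x hF).
Qed.

(** The lowest end of the non-edge outside [F'], if it is not outside [F], lies
    below both ends of the non-edge [a, b] outside [F]; not being adjacent to
    both, it forms with one of them a non-edge that precedes [a, b]. *)
Lemma shelling_exchange F F' : F \in facets (clique_dual e) ->
    F' \in facets (clique_dual e) -> F' != F -> (lowest F' <= lowest F)%N ->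
  exists F'', [/\ F'' \in facets (clique_dual e),
    F'' = F' \/ (lowest F'' < lowest F)%N, F :&: F' \subset F'' &
    #|F'' :&: F| = (#|X| - 3)%N].
Proof.
move=> FD F'D neq le; have /facets_clique_dualP[a [b [ab nab FE]]] := FD.
have /facets_clique_dualP[c0 [d0 [cd0 ncd0 F'E0]]] := F'D.
have c0F' : c0 \notin F' by rewrite F'E0 !inE eqxx.
have [c cF' lc] := lowestP c0F'.
have [d [cd ncd F'E]] : exists d, [/\ c != d, ~~ e c d & F' = ~: [set c; d]].
  move: cF'; rewrite F'E0 !inE negbK => /orP[]/eqP ->; first by exists d0.
  by exists c0; rewrite eq_sym e_sym setUC.
have card3 x y z : x != y -> x != z -> y != z ->
    #|~: [set x; y] :&: ~: [set z; y]| = (#|X| - 3)%N.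
  move=> xy xz yz; rewrite -setCU cardsCs setCK; congr (_ - _)%N.
  have -> : [set x; y] :|: [set z; y] = x |: [set y; z].
    by apply/setP => w; rewrite !inE; do 3 case: eqP => //=.
  by rewrite cardsU1 cards2 yz !inE negb_or xy xz.
case cF : (c \notin F).
  have dF : d \in F.
    apply: contraNT neq => dF; rewrite F'E FE; apply/eqP; congr (~: _).
    move: cF dF cd; rewrite FE !inE !negbK => /orP[]/eqP -> /orP[]/eqP ->; rewrite ?eqxx // => _.
    by rewrite setUC.
  exists F'; split=> //; [by left|exact: subsetIr|].
  move: dF cF; rewrite F'E FE !inE negbK negb_or => /andP[da db].
  case/orP => /eqP cE; subst c.
    by rewrite (setUC [set a] [set b]) setUC card3 // eq_sym.
  by rewrite setUC card3 // eq_sym.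
have cF1 : c \in F by rewrite -[_ \in _]negbK cF.
have /andP[ca cb] : (c != a) && (c != b) by move: cF1; rewrite FE !inE negb_or.
have lca x : x \notin F -> (index c s < index x s)%N.
  move=> xF; rewrite ltn_neqAle -lc (leq_trans le (lowest_le xF)) andbT lc.
  by apply: contraFneq cF => cx; rewrite (index_inj c (s_all c) (s_all x) cx).
have aF : a \notin F by rewrite FE !inE eqxx.
have bF : b \notin F by rewrite FE !inE eqxx orbT.
have [y0 y0F ly0] := lowestP aF.
have main x y : x \notin F -> F = ~: [set y; x] -> y != x -> c != y -> c != x -> ~~ e c x ->
  exists F'', [/\ F'' \in facets (clique_dual e),
    F'' = F' \/ (lowest F'' < lowest F)%N, F :&: F' \subset F'' &
    #|F'' :&: F| = (#|X| - 3)%N].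
  move=> xF FE' xy cy cx ncx; exists (~: [set c; x]); split.
  - by apply/facets_clique_dualP; exists c, x.
  - right; rewrite ly0; apply: leq_ltn_trans (lca _ y0F).
    by apply: lowest_le; rewrite !inE eqxx.
  - rewrite -setCS setCK; apply/subsetP => z; rewrite !inE negb_and.
    by case/orP => /eqP ->; rewrite ?xF // cF' orbT.
  - by rewrite FE' card3 // eq_sym.
case eca : (e c a); last by apply: (main a b); rewrite ?eca // 1?eq_sym // setUC.
apply: (main b a) => //; apply: contra nab => ecb.
by apply: (s_elim _ _ eca ecb); rewrite // index_mem s_all andbT lca.
Qed.

(** The facets are listed by the lower ends of the non-edges that they omit; among
    non-edges with a common lower end the order is irrelevant, since the facets
    then meet in codimension one. *)
Lemma clique_dual_shellable : shellable (clique_dual e).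
Proof.
pose le F G := (lowest F <= lowest G)%N.
have le_total : total le by move=> F G; exact: leq_total.
have le_trans : transitive le by move=> F G H; exact: leq_trans.
pose l := sort le (enum (facets (clique_dual e))).
have lE : l =i facets (clique_dual e) by move=> F; rewrite mem_sort mem_enum.
have l_sorted i j : (i < j < size l)%N -> (lowest (nth set0 l i) <= lowest (nth set0 l j))%N.
  move=> /andP[ij jl]; apply: (sorted_ltn_nth le_trans _ (sort_sorted le_total _)) => //.
  by rewrite inE (ltn_trans ij).
exists (#|X| - 2)%N, l; split=> //.
- exact: card_clique_dual_facet.
- by rewrite sort_uniq enum_uniq.
move=> j /andP[j0 jl]; set Fj := nth set0 l j.
have FjD : Fj \in facets (clique_dual e) by rewrite -lE mem_nth.
have lD i : (i < j)%N -> nth set0 l i \in facets (clique_dual e) /\ nth set0 l i != Fj.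
  move=> ij; split; first by rewrite -lE mem_nth // (ltn_trans ij).
  by rewrite nth_uniq ?(ltn_trans ij) ?sort_uniq ?enum_uniq // neq_ltn ij.
have exch i : (i < j)%N -> exists k, [/\ (k < j)%N, Fj :&: nth set0 l i \subset nth set0 l k
    & #|nth set0 l k :&: Fj| = (#|X| - 3)%N].
  move=> ij; have [FiD Fij] := lD i ij.
  have lij : (lowest (nth set0 l i) <= lowest Fj)%N by apply: l_sorted; rewrite ij.
  have [F'' [F''D F''l sF cF]] := shelling_exchange FjD FiD Fij lij.
  case: F''l sF cF => [->|ltF] sF cF; first by exists i.
  have F''l : F'' \in l by rewrite lE.
  exists (index F'' l); rewrite nth_index //; split=> //.
  rewrite ltnNge; apply/negP; rewrite leq_eqVlt => /predU1P[jE|jlt].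
    by move: ltF; rewrite /Fj jE nth_index // ltnn.
  have := @l_sorted j (index F'' l); rewrite jlt index_mem F''l nth_index // => /(_ isT).
  by rewrite leqNgt ltF.
have X3 : (3 <= #|X|)%N.
  have [F0D F0j] := lD 0 j0; rewrite ltnNge; apply/negP => X2.
  have c0 F : F \in facets (clique_dual e) -> F = set0.
    move/card_clique_dual_facet => cF; apply/eqP.
    by rewrite -cards_eq0 cF subn_eq0.
  by rewrite (c0 _ F0D) (c0 _ FjD) eqxx in F0j.
exists (#|X| - 3)%N; first by rewrite -subSn.
move=> G; rewrite !inE => /andP[/andP[GFj /hasP[F Fl GF]] /forall_inP Gmax].
have [i ij FE] : exists2 i, (i < j)%N & F = nth set0 l i.
  exists (index F l); first by rewrite index_ltn.
  by rewrite nth_index //; exact: mem_take Fl.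
have [k [kj sk <-]] := exch i ij; congr #|pred_of_set _|; apply/eqP; rewrite eq_sym.
have HS : nth set0 l k :&: Fj \in [set G : {set X} | (G \subset Fj)
    && has (fun F : {set X} => G \subset F) (take j l)].
  rewrite inE subsetIr /=; apply/hasP; exists (nth set0 l k); last exact: subsetIl.
  by rewrite in_take_leq ?(ltnW jl) // index_uniq ?sort_uniq ?enum_uniq // (ltn_trans kj).
apply: (implyP (Gmax _ HS)); rewrite subsetI GFj andbT.
by apply: subset_trans sk; rewrite subsetI GFj -FE.
Qed.

End DualShelling.
(** * Homology along a collapse *)

Section Chains.
Variable X : finType.
Implicit Types (K L : complex X) (F G : {set X}) (u v p : X).
Implicit Types (z a b : {set X} -> int) (m : int).

Definition incidence F v : int := (-1) ^+ position F v.

(** The boundary of chains seen as functions on all subsets, zero outside the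
    complex. Degrees then leave the types, and the boundary no longer depends on
    the complex. *)
Definition bd z G : int := \sum_(v | v \notin G) incidence (v |: G) v * z (v |: G).

Lemma bdB a b G : bd (fun F => a F - b F) G = bd a G - bd b G.
Proof. by rewrite /bd -sumrB; apply: eq_bigr => v _; rewrite mulrBr. Qed.

Lemma bdD a b G : bd (fun F => a F + b F) G = bd a G + bd b G.
Proof. by rewrite /bd -big_split /=; apply: eq_bigr => v _; rewrite mulrDr. Qed.

Lemma eq_bd a b G : (forall F, a F = b F) -> bd a G = bd b G.
Proof. by move=> ab; apply: eq_bigr => v _; rewrite ab. Qed.

Lemma positionU1 F u v : v \notin F ->
  position (v |: F) u = ((enum_rank v < enum_rank u) + position F u)%N.
Proof.
move=> vF; rewrite /position; have [vu|vu] := boolP (enum_rank v < enum_rank u)%N.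
  rewrite (_ : [set _ in _ | _] = v |: [set w in F | (enum_rank w < enum_rank u)%N]).
    by rewrite cardsU1 inE (negPf vF) vu.
  apply/setP => w; rewrite !inE; case: eqVneq => [->|] //=; by rewrite vu.
rewrite add0n; congr #|pred_of_set _|.
apply/setP => w; rewrite !inE; case: eqVneq => [->|] //=.
by rewrite (negPf vu) andbF.
Qed.

Lemma incidence_swap G u v : u \notin G -> v \notin G -> u != v ->
  incidence (v |: G) v * incidence (u |: (v |: G)) u =
  - (incidence (u |: G) u * incidence (v |: (u |: G)) v).
Proof.
move=> uG vG uv; have vuG : v \notin u |: G by rewrite !inE negb_or eq_sym uv.
have uvG : u \notin v |: G by rewrite !inE negb_or uv.
rewrite /incidence !positionU1 // !ltnn !add0n !exprD.
have : (enum_rank u < enum_rank v)%N = ~~ (enum_rank v < enum_rank u)%N.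
  rewrite -leqNgt ltn_neqAle; case: eqP => // /ord_inj/enum_rank_inj uE.
  by rewrite uE eqxx in uv.
by move=> ->; case: (enum_rank v < enum_rank u)%N; rewrite /= !expr0 ?expr1; ring.
Qed.

Lemma bd_bd z G : bd (bd z) G = 0.
Proof.
pose f v u := incidence (v |: G) v * incidence (u |: (v |: G)) u * z (u |: (v |: G)).
have -> : bd (bd z) G = \sum_(v | v \notin G) \sum_(u | (u \notin G) && (u != v)) f v u.
  apply: eq_bigr => v vG; rewrite /bd mulr_sumr.
  by apply: eq_big => [u|u _]; rewrite ?mulrA // !inE negb_or andbC.
suff : \sum_(v | v \notin G) \sum_(u | (u \notin G) && (u != v)) f v u =
    - \sum_(v | v \notin G) \sum_(u | (u \notin G) && (u != v)) f v u by lia.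
rewrite [LHS](exchange_big_dep (fun u => u \notin G)) /=; last by move=> v u _ /andP[].
rewrite -sumrN; apply: eq_bigr => v vG; rewrite -sumrN.
apply: eq_big => [u|u /andP[uG vu]]; first by rewrite vG eq_sym.
rewrite vG /= in vu; rewrite /f incidence_swap // 1?eq_sym //.
by rewrite mulNr [u |: (v |: G)]setUCA.
Qed.

(** Here and below [m] is the number of vertices of the faces, one more than the
    degree. *)
Definition chain_in K m z : Prop := forall F, z F != 0 -> F \in K /\ #|F|%:Z = m.

Definition is_cycle z : Prop := forall G, bd z G = 0.

Lemma bd_support z G : bd z G != 0 -> exists2 v, v \notin G & z (v |: G) != 0.
Proof.
move=> nz; have [/existsP[v /andP[vG zv]]|none] :=
  boolP [exists v, (v \notin G) && (z (v |: G) != 0)]; first by exists v.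
rewrite /bd big1 ?eqxx // in nz => v vG; apply/eqP; rewrite mulf_eq0; apply/orP; right.
by apply: contraNT none => zv; apply/existsP; exists v; rewrite vG.
Qed.

Lemma chain_in_bd K m z : chain_in K m z -> chain_in K (m - 1) (bd z).
Proof.
move=> zK G /bd_support[v vG /zK[vK <-]]; split.
  by apply: faces_closed vK _; exact: subsetUr.
by rewrite cardsU1 vG; lia.
Qed.

Lemma chain_inB K m a b : chain_in K m a -> chain_in K m b ->
  chain_in K m (fun F => a F - b F).
Proof.
move=> aK bK F; have [a0|/aK//] := eqVneq (a F) 0.
by rewrite a0 sub0r oppr_eq0 => /bK.
Qed.

Definition acyclic_at K m : Prop := forall z, chain_in K m z -> is_cycle z ->
  exists2 b, chain_in K (m + 1) b & forall G, bd b G = z G.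

(** Pushing the part of a cycle that lies in the open star of [sigma] off that
    star, along the cone structure of the link of [sigma]. *)
Lemma cone_push K sigma p m z : cone_link K sigma p -> chain_in K m z -> is_cycle z ->
  exists2 b, chain_in K (m + 1) b
    & chain_in (delete_star K sigma) m (fun F => z F - bd b F).
Proof.
move=> [psigma cone] zK zcycle.
(* Coning from p the part of z off p; the coefficients of z - bd b then vanish on
   the faces of the star that avoid p, hence also on the others, as p is the only
   vertex by which these can be completed. *)
pose b F : int := if [&& p \in F & sigma \subset F]
  then incidence F p * z (F :\ p) else 0.
have sub_p F : sigma \subset F -> sigma \subset F :\ p.
  by move=> sF; apply/subsetD1P.
have bK : chain_in K (m + 1) b.
  move=> F; rewrite /b; case: ifP => [/andP[pF sF]|_]; last by rewrite eqxx.
  rewrite mulf_eq0 negb_or => /andP[_ /zK[FK cF]].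
  rewrite -(setD1K pF) cone ?sub_p //; split=> //.
  by rewrite cardsU1 !inE eqxx /= -cF; lia.
exists b => //.
pose z' F := z F - bd b F.
have z'K : chain_in K m z'.
  apply: chain_inB => //; have := chain_in_bd bK.
  by rewrite addrK.
have z'0 F : sigma \subset F -> p \notin F -> z' F = 0.
  move=> sF pF; rewrite /z' /bd (bigD1 p) //= big1 => [|v /andP[vF vp]]; last first.
    by rewrite /b in_setU1 eq_sym (negPf vp) (negPf pF) /= mulr0.
  rewrite /b in_setU1 eqxx /= (subset_trans sF (subsetUr _ _)) setU1K //.
  by rewrite addr0 mulrA -expr2 /incidence sqrr_sign mul1r subrr.
have z'cycle : is_cycle z'.
  by move=> G; rewrite bdB zcycle bd_bd subrr.
move=> F; rewrite -/(z' F) => z'F; have [FK cF] := z'K F z'F.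
split=> //; rewrite in_delete_star FK /=; apply/negP => sF.
have pF : p \in F by apply: contraNT z'F => pF; rewrite z'0.
have := z'cycle (F :\ p); rewrite /bd (bigD1 p) ?in_setD1 ?eqxx //= big1 => [|v /andP[vF vp]].
  by rewrite addr0 setD1K // => /eqP; rewrite mulf_eq0 (negPf z'F) signr_eq0.
rewrite z'0 ?mulr0 //; first exact: subset_trans (sub_p _ sF) (subsetUr _ _).
by rewrite !in_setU1 in_setD1 eqxx /= eq_sym (negPf vp).
Qed.

(** The homology of a wedge of spheres of one dimension: the coefficients on the
    faces [tau i] are coordinates on the top cycles. *)
Record spherical_basis (I : finType) K m (tau : I -> {set X}) : Prop := {
  basis_dim : forall F, F \in K -> #|F|%:Z <= m ;
  basis_acyclic : forall m', m' != m -> acyclic_at K m' ;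
  basis_inj : forall z, chain_in K m z -> is_cycle z ->
    (forall i, z (tau i) = 0) -> forall F, z F = 0 ;
  basis_surj : forall n : I -> int, exists z,
    [/\ chain_in K m z, is_cycle z & forall i, z (tau i) = n i] }.

Lemma spherical_basis_cone (I : finType) K sigma p m (tau : I -> {set X}) :
  cone_link K sigma p -> (forall F, F \in K -> #|F|%:Z <= m) ->
  spherical_basis (delete_star K sigma) m tau -> spherical_basis K m tau.
Proof.
move=> cK dimK [_ acycL injL surjL].
have sub m' z : chain_in (delete_star K sigma) m' z -> chain_in K m' z.
  by move=> zL F /zL[]; rewrite in_delete_star => /andP[].
(* In the top degree the chain b of cone_push is zero: nothing is moved. *)
have top b : chain_in K (m + 1) b -> forall F, b F = 0.
  move=> bK F; apply/eqP/negPn/negP => /bK[FK cF].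
  by have := dimK F FK; rewrite cF; lia.
split=> //.
- move=> m' neq z zK zcycle; have [b bK z'L] := cone_push cK zK zcycle.
  have [|a aL aE] := acycL m' neq _ z'L.
    by move=> G; rewrite bdB zcycle bd_bd subrr.
  exists (fun F => a F + b F) => [F|G].
    have [a0|/(sub _ _ aL)//] := eqVneq (a F) 0.
    by rewrite a0 add0r => /bK.
  by rewrite bdD aE subrK.
- move=> z zK zcycle z0; have [b /top b0 z'L] := cone_push cK zK zcycle.
  have bdb F : bd b F = 0 by rewrite /bd big1 // => v _; rewrite b0 mulr0.
  apply: injL zcycle z0 => F zF; apply: z'L.
  by rewrite bdb subr0.
- move=> n; have [z [zL zcycle zn]] := surjL n; exists z; split=> //.
  exact: sub.
Qed.

Lemma spherical_basis_collapses (I : finType) K L m (tau : I -> {set X}) : collapses K L ->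
  (forall F, F \in K -> #|F|%:Z <= m) ->
  spherical_basis L m tau -> spherical_basis K m tau.
Proof.
elim=> // {}K {}L sigma p cK _ IH dimK LB.
apply: (spherical_basis_cone cK) => //; apply: IH LB => F.
by rewrite in_delete_star => /andP[/dimK].
Qed.

Lemma spherical_basis_void m (tau : 'I_0 -> {set X}) :
  spherical_basis void_complex m tau.
Proof.
have void m' z : chain_in void_complex m' z -> forall F, z F = 0.
  by move=> zK F; apply/eqP/negPn/negP => /zK[]; rewrite inE.
have bd0 G : bd (fun=> 0) G = 0 by rewrite /bd big1 // => v _; rewrite mulr0.
split.
- by move=> F; rewrite inE.
- move=> m' _ z /void z0 _; exists (fun=> 0) => [F|G]; first by rewrite eqxx.
  by rewrite bd0 z0.
- by move=> z /void z0.
- by move=> n; exists (fun=> 0); split=> [F|//|[]//]; rewrite eqxx.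
Qed.

(** The boundary of an added top face bounds a chain of the acyclic complex [L];
    the two together form a new cycle. *)
Lemma spherical_basis_facets (I : finType) K L m (tau0 : 'I_0 -> {set X})
    (tau : I -> {set X}) : injective tau ->
  (forall i, tau i \notin L) -> (forall i, #|tau i|%:Z = m) ->
  faces K = [set F | (F \in L) || [exists i, F == tau i]] ->
  spherical_basis L m tau0 -> spherical_basis K m tau.
Proof.
move=> tau_inj tauL tau_m KE [dimL acycL injL _].
have inK F : (F \in K) = (F \in L) || [exists i, F == tau i] by rewrite KE inE.
have toL m' z : chain_in K m' z -> (forall i, z (tau i) = 0) -> chain_in L m' z.
  move=> zK z0 F zF; have [FK cF] := zK F zF; split=> //; move: FK; rewrite inK.
  by case/orP=> // /existsP[i /eqP FE]; rewrite FE z0 eqxx in zF.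
have toK m' z : chain_in L m' z -> chain_in K m' z.
  by move=> zL F /zL[FL ->]; rewrite inK FL.
have inj0 z : chain_in L m z -> is_cycle z -> forall F, z F = 0.
  by move=> zL zc; apply: injL => // -[].
split.
- by move=> F; rewrite inK => /orP[/dimL//|/existsP[i /eqP ->]]; rewrite tau_m.
- move=> m' neq z zK zcycle; have zL : chain_in L m' z.
    apply: toL => // i; apply/eqP/negPn/negP => /zK[_ mE].
    by rewrite -mE tau_m eqxx in neq.
  by have [b bL bE] := acycL m' neq z zL zcycle; exists b => //; exact: toK.
- by move=> z zK zcycle z0; apply: inj0 => //; exact: toL.
move=> n; pose a F : int := \sum_(i | F == tau i) n i.
have aE i : a (tau i) = n i.
  rewrite /a (big_pred1 i) // => j; rewrite eq_sym; exact: inj_eq.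
have aP F : a F != 0 -> exists i, F = tau i.
  have [/existsP[i /eqP ->] _|none] := boolP [exists i, F == tau i]; first by exists i.
  rewrite /a big_pred0 ?eqxx // => i; apply/negbTE.
  by move: none; rewrite negb_exists => /forallP/(_ i).
have aK : chain_in K m a.
  move=> F /aP[i ->]; rewrite inK; split; rewrite ?tau_m //.
  by apply/orP; right; apply/existsP; exists i.
have baL : chain_in L (m - 1) (bd a).
  move=> G /(chain_in_bd aK)[GK cG]; split=> //; move: GK; rewrite inK.
  by case/orP=> // /existsP[i /eqP GE]; have := tau_m i; rewrite -GE cG; lia.
have [|b bL bE] := acycL (m - 1) _ _ baL (bd_bd a).
  by apply/eqP; lia.
rewrite subrK in bL.
exists (fun F => a F - b F); split.
- by apply: chain_inB => //; exact: toK.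
- by move=> G; rewrite bdB bE subrr.
move=> i; rewrite aE; have -> : b (tau i) = 0; last by rewrite subr0.
by apply/eqP/negPn/negP => /bL[]; rewrite (negPf (tauL i)).
Qed.

End Chains.

(** * Reduced homology groups *)

Section ReducedHomology.
Variables (X : finType) (K : complex X).
Implicit Types (F G : {set X}) (v : X) (q : int).

Definition extension q (a : chain K q) F : int := oapp a 0 (insub F).

Lemma extension_face q (a : chain K q) (f : face K q) : extension a (val f) = a f.
Proof. by rewrite /extension valK. Qed.

Lemma extension_in q (a : chain K q) : chain_in K (q + 1) (extension a).
Proof.
move=> F; rewrite /extension; case: insubP => [f /andP[FK /eqP cF] _|_] //=.
Qed.

Definition restriction q (z : {set X} -> int) : chain K q := [ffun f => z (val f)].

Lemma restrictionK q z : chain_in K (q + 1) z -> extension (restriction q z) =1 z.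
Proof.
move=> zK F; rewrite /extension; case: insubP => [f _ <-|nF] /=; first by rewrite ffunE.
apply/esym/eqP; apply: contraNT nF => /zK[-> ->].
by rewrite eqxx.
Qed.

Lemma boundaryE p q (a : chain K p) (G : face K q) :
  boundary q a G = bd (extension a) (val G).
Proof.
rewrite ffunE (exchange_big_dep predT) //= /bd [RHS]big_mkcond /=.
apply: eq_bigr => v _; case: ifPn => vG; last first.
  rewrite big_pred0 // => F; apply/negbTE; apply: contraNN vG => /andP[_ /eqP <-].
  by rewrite in_setD1 eqxx.
have FE (F : face K p) : (v \in val F) && (val F :\ v == val G) = (val F == v |: val G).
  apply/andP/eqP => [[vF /eqP <-]|->]; first by rewrite setD1K.
  by rewrite !inE eqxx setU1K.
rewrite (eq_bigl _ _ FE); rewrite /extension; case: insubP => [F _ FE'|nF] /=.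
  rewrite (big_pred1 F) ?FE' // => F'; apply/eqP/eqP => [F'E|-> //].
  by apply: val_inj; rewrite FE'.
rewrite mulr0 big_pred0 // => F; apply: contraNF nF => /eqP <-; exact: (valP F).
Qed.

Lemma boundary_eqP q (a : chain K (q + 1)) (z : chain K q) :
  boundary q a = z <-> (forall G, bd (extension a) G = extension z G).
Proof.
split=> [<- G|aE]; last by apply/ffunP => G; rewrite boundaryE aE extension_face.
rewrite {2}/extension; case: insubP => [f _ <-|nG] /=; first by rewrite boundaryE.
apply/eqP; apply: contraNT nG => /(chain_in_bd (@extension_in _ a))[-> ->].
by rewrite addrK eqxx.
Qed.

Lemma cyclesP q (a : chain K q) : reflect (is_cycle (extension a)) (a \in @cycles X K q).
Proof.
rewrite inE; apply: (iffP eqP) => [a0 G|ac]; last first.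
  by apply/ffunP => G; rewrite boundaryE ac ffunE.
apply/eqP/negPn/negP => nz; have [GK cG] := chain_in_bd (@extension_in _ a) nz.
have fG : (G \in K) && (#|G|%:Z == q - 1 + 1) by rewrite GK cG addrK subrK eqxx.
have := congr1 (fun b : chain K (q - 1) => b (exist _ G fG)) a0.
by rewrite boundaryE /= ffunE => bG; rewrite bG eqxx in nz.
Qed.

Lemma boundariesP q (x : cycle_group K q) :
  reflect (exists2 b, chain_in K (q + 1 + 1) b &
             forall G, bd b G = extension (val x) G) (x \in @boundaries X K q).
Proof.
rewrite inE; apply: (iffP (asboolP _)) => [[b /boundary_eqP bE]|[b bK bE]].
  by exists (extension b) => //; exact: extension_in.
exists (restriction (q + 1) b); apply/boundary_eqP => G; rewrite -bE.
by apply: eq_bd; exact: restrictionK.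
Qed.

Lemma homology_acyclic q : acyclic_at K (q + 1) ->
  forall z : reduced_homology K q, z = 0.
Proof.
move=> acyc z; rewrite -[z]reprK; set x := repr z.
have /boundariesP xB : exists2 b, chain_in K (q + 1 + 1) b &
    forall G, bd b G = extension (val x) G.
  by apply: acyc; [exact: extension_in|exact/cyclesP/valP].
have -> : 0 = (\pi_(reduced_homology K q) 0)%qT :> reduced_homology K q by rewrite piE.
by apply/eqP; rewrite -Quotient.idealrBE subr0.
Qed.

(** In the top degree no boundary is non-zero, so a homology class is a cycle
    and evaluation on the [tau i] is an isomorphism. *)
Lemma homology_top k q (tau : 'I_k -> {set X}) : spherical_basis K (q + 1) tau ->
  zmod_isomorphic (reduced_homology K q) 'rV[int]_k.
Proof.
move=> [dimK _ injK surjK].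
have reprE (x : cycle_group K q) : repr (\pi_(reduced_homology K q) x)%qT = x.
  apply/eqP; rewrite -subr_eq0; set d := _ - x.
  have /boundariesP[b bK bE] : d \in @boundaries X K q.
    by rewrite Quotient.idealrBE reprK.
  have b0 F : b F = 0.
    by apply/eqP/negPn/negP => /bK[/dimK + cF]; rewrite cF; lia.
  apply/eqP/val_inj/ffunP => f; rewrite -extension_face -bE ffunE.
  by rewrite /bd big1 // => v _; rewrite b0 mulr0.
pose ev (h : reduced_homology K q) : 'rV[int]_k :=
  \row_i extension (val (repr h)) (tau i).
have evB : {morph ev : x y / x - y}.
  move=> x y; rewrite -[x]reprK -[y]reprK; set a := repr x; set b := repr y.
  have -> : (\pi_(reduced_homology K q) a - \pi_(reduced_homology K q) b)%qT
      = (\pi_(reduced_homology K q) (a - b))%qT by rewrite piE.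
  apply/rowP => i; rewrite /ev !reprE !mxE /extension.
  by case: insub => [f|] /=; rewrite ?subr0 // !ffunE.
have ev_inj : injective ev.
  move=> x y xy; rewrite -[x]reprK -[y]reprK; congr (\pi_(_) _)%qT; apply: val_inj.
  have xyc := valP (repr x - repr y).
  apply/eqP; rewrite -subr_eq0; apply/eqP/ffunP => f.
  rewrite -[LHS]extension_face [RHS]ffunE.
  apply: (injK (extension (val (repr x - repr y)))); first exact: extension_in.
    by apply/cyclesP.
  move=> i; have /rowP/(_ i) := xy; rewrite !mxE /extension.
  by case: insub => [g|] //= xyi; rewrite !ffunE xyi subrr.
pose z (n : 'rV[int]_k) := projT1 (cid (surjK (n ord0))).
have zP n : [/\ chain_in K (q + 1) (z n), is_cycle (z n)
    & forall i, z n (tau i) = n ord0 i] by exact: projT2 (cid (surjK (n ord0))).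
have zc n : restriction q (z n) \in @cycles X K q.
  have [zK zcycle _] := zP n; apply/cyclesP => G.
  by rewrite -[RHS](zcycle G); apply: eq_bd; exact: restrictionK.
pose back n : reduced_homology K q :=
  (\pi_(reduced_homology K q) (exist _ (restriction q (z n)) (zc n)))%qT.
have backK n : ev (back n) = n.
  apply/rowP => i; have [zK _ <-] := zP n.
  by rewrite mxE reprE /= restrictionK.
pose evM := GRing.isZmodMorphism.Build _ _ ev evB.
exists (HB.pack_for {additive reduced_homology K q -> 'rV[int]_k} ev evM).
exists back => //= x; apply: ev_inj; exact: backK.
Qed.

End ReducedHomology.
(** * The reduced Euler characteristic *)

Section Euler.
Variable X : finType.
Implicit Types (K L : complex X) (F G sigma : {set X}) (p : X).

Lemma signz_pred (n : nat) : (-1) ^ (n%:Z - 1) = - (-1) ^+ n :> int.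
Proof. by rewrite exprzDr ?unitrN1 //= mulrN1. Qed.

Lemma reduced_eulerE K : reduced_euler K = - \sum_(F in K) (-1) ^+ #|F|.
Proof.
rewrite (partition_big (fun F : {set X} => inord #|F| : 'I_#|X|.+1) predT) //= -sumrN.
apply: eq_bigr => i _.
rewrite (eq_bigl [pred F | F \in [set F in K | #|F|%:Z == i%:Z - 1 + 1]]); last first.
  move=> F; rewrite !inE subrK; congr (_ && _).
  by rewrite -val_eqE /= inordK ?ltnS ?max_card.
rewrite (eq_bigr (fun=> (-1) ^+ i)) => [|F]; last first.
  by rewrite !inE subrK => /andP[_ /eqP[->]].
by rewrite sumr_const signz_pred mulNr -mulr_natr natz.
Qed.

(** Adding or dropping the apex [p] pairs off the faces of the star with opposite
    signs. *)
Lemma euler_cone K sigma p : cone_link K sigma p ->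
  reduced_euler K = reduced_euler (delete_star K sigma).
Proof.
move=> [psigma cone]; rewrite !reduced_eulerE; congr (- _).
rewrite (bigID (fun F => sigma \subset F)) /= addrC.
rewrite (eq_bigl (mem (delete_star K sigma))) => [|F]; last by rewrite /= in_delete_star.
rewrite -[RHS]addr0; congr (_ + _).
pose h F := if p \in F then F :\ p else p |: F.
have hK : involutive h.
  move=> F; rewrite /h; case pF: (p \in F); first by rewrite !inE eqxx setD1K.
  by rewrite !inE eqxx setU1K ?pF.
have hP F : (h F \in K) && (sigma \subset h F) = (F \in K) && (sigma \subset F).
  have imp G : (G \in K) && (sigma \subset G) -> (h G \in K) && (sigma \subset h G).
    case/andP=> GK sG; rewrite /h; case: ifPn => pG.
      by rewrite (faces_closed GK) ?subD1set //=; apply/subsetD1P.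
    by rewrite cone //= (subset_trans sG) // subsetUr.
  by apply/idP/idP => /imp //; rewrite hK.
have opp0 (x : int) : x = - x -> x = 0 by lia.
apply: opp0.
rewrite [LHS](reindex_inj (inv_inj hK)) /= -sumrN; apply: eq_big => // F _.
rewrite /h; case: ifPn => pF; last by rewrite cardsU1 pF exprS mulN1r.
by rewrite [in RHS](cardsD1 p) pF exprS mulN1r opprK.
Qed.

Lemma euler_collapses K L : collapses K L -> reduced_euler K = reduced_euler L.
Proof. by elim=> // {}K {}L sigma p /euler_cone -> _. Qed.

Lemma euler_void : reduced_euler (@void_complex X) = 0.
Proof. by rewrite reduced_eulerE big_pred0 ?oppr0 // => F; rewrite inE. Qed.

Lemma euler_facets (I : finType) K L (n : nat) (tau : I -> {set X}) :
  injective tau -> (forall i, tau i \notin L) -> (forall i, #|tau i| = n) ->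
  faces K = [set F | (F \in L) || [exists i, F == tau i]] ->
  reduced_euler K = reduced_euler L + (-1) ^ (n%:Z - 1) * #|I|%:Z.
Proof.
move=> tau_inj tauL tau_n KE; rewrite !reduced_eulerE signz_pred mulNr -opprD.
congr (- _); rewrite (bigID (mem L)) /=; congr (_ + _).
  apply: eq_bigl => F; rewrite KE inE.
  by case: (F \in L); rewrite ?andbT ?andbF.
rewrite (eq_bigl (mem [set tau i | i in I])) => [|F]; last first.
  rewrite /= KE inE; apply/idP/imsetP => [/andP[/orP[->//|/existsP[i /eqP ->] _]]|[i _ ->]].
    by exists i.
  by rewrite tauL andbT; apply/orP; right; apply/existsP; exists i.
rewrite big_imset /=; last by move=> i j _ _; exact: tau_inj.
rewrite (eq_bigr (fun=> (-1) ^+ n)) => [|i _]; last by rewrite tau_n.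
by rewrite sumr_const -mulr_natr natz.
Qed.

End Euler.
(** * Continuity *)

Section Continuity.
Variable R : realType.
Implicit Types (T U V : topologicalType).
Local Open Scope classical_set_scope.

Lemma continuous_sum T (I : Type) (s : seq I) (P : pred I) (f : I -> T -> R) :
  (forall i, continuous (f i)) -> continuous (fun t => \sum_(i <- s | P i) f i t).
Proof.
move=> cf; elim: s => [|i s IH] t.
  rewrite (_ : (fun t => _) = fun=> 0); first exact: cvg_cst.
  by apply/funext => u; rewrite big_nil.
rewrite (_ : (fun t => _) =
  fun t => (if P i then f i t else 0) + \sum_(i <- s | P i) f i t); last first.
  by apply/funext => u; rewrite big_cons; case: (P i); rewrite ?add0r.
apply: continuousD; last exact: IH.
by case: (P i); [exact: cf|exact: cvg_cst].
Qed.

Lemma continuous_addr T (f g : T -> R) : continuous f -> continuous g ->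
  continuous (fun t => f t + g t).
Proof. by move=> cf cg t; apply: continuousD; [exact: cf|exact: cg]. Qed.

Lemma continuous_subr T (f g : T -> R) : continuous f -> continuous g ->
  continuous (fun t => f t - g t).
Proof. by move=> cf cg t; apply: continuousB; [exact: cf|exact: cg]. Qed.

Lemma continuous_mulr T (f g : T -> R) : continuous f -> continuous g ->
  continuous (fun t => f t * g t).
Proof. by move=> cf cg t; apply: continuousM; [exact: cf|exact: cg]. Qed.

Lemma continuous_divr T (f g : T -> R) : continuous f -> continuous g ->
  (forall t, g t != 0) -> continuous (fun t => f t / g t).
Proof.
move=> cf cg g0; apply: continuous_mulr => // t.
by apply: continuousV; [exact: g0|exact: cg].
Qed.

Lemma continuous_cstr T (c : R) : continuous (fun _ : T => c).
Proof. by move=> t; exact: cvg_cst. Qed.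

Lemma continuous_minr T (f g : T -> R) : continuous f -> continuous g ->
  continuous (fun t => Num.min (f t) (g t)).
Proof. by move=> cf cg t; apply: continuous_min; [exact: cf|exact: cg]. Qed.

Lemma continuous_maxr T (f g : T -> R) : continuous f -> continuous g ->
  continuous (fun t => Num.max (f t) (g t)).
Proof. by move=> cf cg t; apply: continuous_max; [exact: cf|exact: cg]. Qed.

Lemma continuous_comp_fun T U V (f : T -> U) (g : U -> V) : continuous f ->
  continuous g -> continuous (fun t => g (f t)).
Proof. by move=> cf cg t; apply: continuous_comp; [exact: cf|exact: cg]. Qed.

Lemma continuous_fst T U : continuous (@fst T U).
Proof. by move=> t; exact: cvg_fst. Qed.

Lemma continuous_snd T U : continuous (@snd T U).
Proof. by move=> t; exact: cvg_snd. Qed.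

Lemma continuous_pairf T U V (f : T -> U) (g : T -> V) : continuous f ->
  continuous g -> continuous (fun t => (f t, g t)).
Proof. by move=> cf cg t; apply: cvg_pair; [exact: cf|exact: cg]. Qed.

Section FunctionSpaces.
Variables (I : choiceType) (A : set {ptws I -> R}).

Lemma continuous_coord i : continuous (fun t : classical_sets.set_type A => val t i).
Proof.
move=> t; apply: (@continuous_comp _ _ _
  (set_val : classical_sets.set_type A -> {ptws I -> R}) (proj i)).
  exact: initial_continuous.
exact: proj_continuous.
Qed.

Lemma continuous_into T (f : T -> classical_sets.set_type A) :
  (forall i, continuous (fun t => val (f t) i)) -> continuous f.
Proof.
move=> cf; apply: continuous_comp_initial => t.
apply/cvg_sup => i V [W [[B oB <-] Bt] WV].
have /cf : nbhs (val (f t) i) B by apply: open_nbhs_nbhs.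
move=> fB; apply: (@filterS _ (nbhs t) _ _ _ _ fB) => u Bu; exact: WV.
Qed.

End FunctionSpaces.

(** The functions [g i] are continuous everywhere and not only on the pieces
    [A i] of the closed cover, which keeps subspaces out of the statement. *)
Lemma continuous_closed_cover T U (I : finType) (A : I -> set T) (f : T -> U)
    (g : I -> T -> U) : (forall i, closed (A i)) -> (forall t, exists i, A i t) ->
  (forall i, continuous (g i)) -> (forall i t, A i t -> f t = g i t) -> continuous f.
Proof.
move=> Acl Acov cg fg t V /= fV.
have near_i i : \forall u \near t, A i u -> V (f u).
  have [At|At] := pselect (A i t).
    have : nbhs (g i t) V by rewrite -(fg i t At).
    move=> /(cg i t) gV; apply: (@filterS _ (nbhs t) _ _ _ _ gV) => u {}gV Au.
    by rewrite (fg i u Au).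
  have : nbhs t (~` A i) by apply: open_nbhs_nbhs; split=> //; exact: closed_openC.
  by apply: filterS => u.
have all_i := filter_forall (nbhs_filter t) near_i.
apply: (@filterS _ (nbhs t) _ _ _ _ all_i) => u Au.
by have [i] := Acov u; exact: Au.
Qed.

Lemma continuous_within_comp T U V (A : set U) (h : U -> V) (f : T -> U) :
  {within A, continuous h} -> continuous f -> (forall t, A (f t)) ->
  continuous (fun t => h (f t)).
Proof.
move=> ch cf Af t W hW.
have Ah := (subspace_continuousP _ _).1 ch (f t) (Af t) W hW.
by apply: (@filterS _ (nbhs t) _ _ _ _ (cf t _ Ah)) => u; apply; exact: Af.
Qed.

End Continuity.

(** * Homotopies *)

Section Homotopy.
Variable R : realType.
Implicit Types (T U V W : topologicalType).
Local Open Scope classical_set_scope.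

Definition clamp (s : R) : R := Num.min (Num.max s 0) 1.

Lemma clamp_ge0 s : 0 <= clamp s.
Proof. by rewrite le_min ler01 le_max lexx orbT. Qed.

Lemma clamp_le1 s : clamp s <= 1.
Proof. by rewrite ge_min lexx orbT. Qed.

Lemma clamp_id s : 0 <= s <= 1 -> clamp s = s.
Proof.
by move=> /andP[s0 s1]; rewrite /clamp (max_idPl s0) (min_idPl s1).
Qed.

Lemma clamp0 : clamp 0 = 0. Proof. by rewrite clamp_id // lexx ler01. Qed.

Lemma clamp1 : clamp 1 = 1. Proof. by rewrite clamp_id // lexx ler01. Qed.

Lemma continuous_clamp : continuous clamp.
Proof.
apply: continuous_minr; last exact: continuous_cstr.
by apply: continuous_maxr; [move=> s; exact: cvg_id|exact: continuous_cstr].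
Qed.

(** Clamping the time to the unit interval makes a homotopy continuous on the
    whole of [T * R], where continuity composes freely. *)
Lemma homotopicP T U (f g : T -> U) :
  homotopic R f g <-> exists h : T * R -> U,
    [/\ continuous h, forall x, h (x, 0) = f x & forall x, h (x, 1) = g x].
Proof.
split=> [[h [ch h0 h1]]|[h [ch h0 h1]]]; last first.
  by exists h; split=> //; exact: continuous_subspaceT.
exists (fun p => h (p.1, clamp p.2)); split=> [|x|x]; rewrite ?clamp0 ?clamp1 //.
apply: (continuous_within_comp ch).
  apply: continuous_pairf; first exact: continuous_fst.
  by apply: continuous_comp_fun; [exact: continuous_snd|exact: continuous_clamp].
by move=> p; split=> //=; rewrite in_itv /= clamp_ge0 clamp_le1.
Qed.

Lemma homotopic_refl T U (f : T -> U) : continuous f -> homotopic R f f.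
Proof.
move=> cf; apply/homotopicP; exists (fun p => f p.1); split=> //.
by apply: continuous_comp_fun; [exact: continuous_fst|].
Qed.

Lemma homotopic_sym T U (f g : T -> U) : homotopic R f g -> homotopic R g f.
Proof.
move=> /homotopicP[h [ch h0 h1]]; apply/homotopicP.
exists (fun p => h (p.1, 1 - p.2)); split=> [|x|x]; rewrite ?subrr ?subr0 //.
apply: continuous_comp_fun ch; apply: continuous_pairf; first exact: continuous_fst.
by apply: continuous_subr; [exact: continuous_cstr|exact: continuous_snd].
Qed.

(** The two homotopies are run at double speed; each is extended as a constant
    beyond its half of the interval, so that [continuous_closed_cover] applies. *)
Lemma homotopic_trans T U (f g k : T -> U) :
  homotopic R f g -> homotopic R g k -> homotopic R f k.
Proof.
move=> /homotopicP[h [ch h0 h1]] /homotopicP[l [cl l0 l1]]; apply/homotopicP.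
pose first_half (p : T * R) := h (p.1, Num.min (p.2 *+ 2) 1).
pose second_half (p : T * R) := l (p.1, Num.max (p.2 *+ 2 - 1) 0).
pose A (b : bool) := if b then [set p : T * R | p.2 <= 2^-1]
                     else [set p : T * R | 2^-1 <= p.2].
exists (fun p => if p.2 <= 2^-1 then first_half p else second_half p).
have half : (2^-1 : R) *+ 2 = 1 by rewrite -[LHS]mulr_natr mulVf // pnatr_eq0.
have c2 : continuous (fun p : T * R => p.2 *+ 2).
  by apply: continuous_addr; exact: continuous_snd.
split=> [|x|x] /=.
- apply: (@continuous_closed_cover (T * R)%type U bool A _
    (fun b => if b then first_half else second_half)).
  + case; rewrite /A.
      apply: (@preimage_closed _ _ snd [set s : R | s <= 2^-1]); last exact: closed_le.
      by move=> p _; exact: continuous_snd.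
    apply: (@preimage_closed _ _ snd [set s : R | 2^-1 <= s]); last exact: closed_ge.
    by move=> p _; exact: continuous_snd.
  + by move=> p; have [le|lt] := leP p.2 2^-1; [exists true|exists false; apply: ltW].
  + case; apply: continuous_comp_fun; [|exact: ch| |exact: cl];
      apply: continuous_pairf; try exact: continuous_fst.
      by apply: continuous_minr => //; exact: continuous_cstr.
    apply: continuous_maxr; last exact: continuous_cstr.
    by apply: continuous_subr => //; exact: continuous_cstr.
  + case=> p; rewrite /A /=; first by move=> ->.
    rewrite le_eqVlt => /predU1P[pE|lt]; last by rewrite leNgt lt.
    rewrite -pE lexx /first_half /second_half -pE half subrr.
    by rewrite minxx maxxx h1 l0.
- by rewrite invr_ge0 ler0n /first_half /= mul0rn (min_idPl ler01) h0.
- rewrite leNgt invf_lt1 ?ltr1n //= /second_half /=.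
  by rewrite mulr2n addrK (max_idPl ler01) l1.
Qed.

Lemma homotopic_comp T U V (f f' : T -> U) (g : U -> V) : continuous g ->
  homotopic R f f' -> homotopic R (g \o f) (g \o f').
Proof.
move=> cg /homotopicP[h [ch h0 h1]]; apply/homotopicP; exists (g \o h).
split=> [|x|x] /=; rewrite ?h0 ?h1 //.
exact: continuous_comp_fun ch cg.
Qed.

Lemma homotopic_precomp T U V (f : T -> U) (g g' : U -> V) : continuous f ->
  homotopic R g g' -> homotopic R (g \o f) (g' \o f).
Proof.
move=> cf /homotopicP[h [ch h0 h1]]; apply/homotopicP.
exists (fun p => h (f p.1, p.2)); split=> [|x|x] /=; rewrite ?h0 ?h1 //.
apply: continuous_comp_fun ch; apply: continuous_pairf; last exact: continuous_snd.
by apply: continuous_comp_fun cf; exact: continuous_fst.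
Qed.

Lemma homotopy_equivalent_refl T : homotopy_equivalent R T T.
Proof.
by exists id, id; split; rewrite ?compid //; try (by move=> x; exact: cvg_id);
  apply: homotopic_refl => x; exact: cvg_id.
Qed.

Lemma homotopy_equivalent_trans T U V : homotopy_equivalent R T U ->
  homotopy_equivalent R U V -> homotopy_equivalent R T V.
Proof.
move=> [f [g [cf cg gf fg]]] [f' [g' [cf' cg' gf' fg']]].
exists (f' \o f), (g \o g'); split.
- exact: continuous_comp_fun.
- exact: continuous_comp_fun.
- apply: homotopic_trans gf.
  by have := homotopic_precomp cf (homotopic_comp cg gf').
- apply: homotopic_trans fg'.
  by have := homotopic_precomp cg' (homotopic_comp cf' fg).
Qed.

Lemma contractible_equivalent T U :
  homotopy_equivalent R T U -> contractible R U -> contractible R T.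
Proof.
move=> [f [g [cf cg gf _]]] [x0 cU]; exists (g x0).
apply: homotopic_trans (homotopic_sym gf) _.
exact: (homotopic_precomp cf (homotopic_comp cg cU)).
Qed.

End Homotopy.
(** * The topology of a collapse *)

Section Least.
Variables (R : realType) (X : finType).
Implicit Types (A : {set X}) (t : X -> R) (a x : X).

(** Seeding the iterated minimum with the value at a member [a] of [A] makes up for
    the lack of a neutral element of [Num.min]. *)
Definition least a A t : R := \big[Num.min/t a]_(x in A) t x.

Lemma least_le a A t x : x \in A -> least a A t <= t x.
Proof. by move=> xA; rewrite /least; exact: (bigmin_le_cond (t a)). Qed.

Lemma least_attained a A t : a \in A -> exists2 x, x \in A & least a A t = t x.
Proof.
move=> aA; rewrite /least.
apply: (big_ind (fun v => exists2 x, x \in A & v = t x)); first by exists a.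
  move=> u v [x xA ->] [y yA ->].
  by rewrite minEle; case: ifP; [exists x|exists y].
by move=> x xA; exists x.
Qed.

Lemma least_eq a A t x : a \in A -> x \in A -> {in A, forall y, t x <= t y} ->
  least a A t = t x.
Proof.
move=> aA xA x_min; apply/eqP; rewrite eq_le least_le //=.
by have [y yA ->] := least_attained t aA; apply: x_min.
Qed.

Lemma least_ge0 a A t : a \in A -> {in A, forall x, 0 <= t x} -> 0 <= least a A t.
Proof. by move=> aA t0; have [x xA ->] := least_attained t aA; apply: t0. Qed.

Lemma continuous_least (T : topologicalType) a A (f : T -> X -> R) :
  (forall x, continuous (f^~ x)) -> continuous (fun u => least a A (f u)).
Proof.
move=> cf; rewrite /least.
have -> : (fun u => \big[Num.min/f u a]_(x in A) f u x) =
    (fun u => \big[Num.min/f u a]_(x <- enum A) f u x).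
  by apply/funext => u; rewrite big_enum.
elim: (enum A) => [|x s IH].
  rewrite (_ : (fun u => _) = f^~ a); first exact: cf.
  by apply/funext => u; rewrite big_nil.
rewrite (_ : (fun u => _) =
    fun u => Num.min (f u x) (\big[Num.min/f u a]_(x <- s) f u x)).
  by apply: continuous_minr => //; exact: cf.
by apply/funext => u; rewrite big_cons.
Qed.

End Least.

Section Realization.
Variables (R : realType) (X : finType).
Implicit Types (K L : complex X) (A F sigma : {set X}) (p x : X).

Definition support (t : X -> R) : {set X} := [set x | t x != 0].

Section Points.
Variable K : complex X.
Variable t : realization R K.

Lemma realizationP : realization_set K (val t).
Proof. exact: set_mem (valP t). Qed.

Lemma coord_ge0 x : 0 <= val t x.
Proof. by have [] := realizationP. Qed.

Lemma coord_sum : \sum_x val t x = 1.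
Proof. by have [] := realizationP. Qed.

Lemma support_face : support (val t) \in K.
Proof. by have [] := realizationP. Qed.

End Points.

Definition mk_point K (t : X -> R) (tK : realization_set K t) : realization R K :=
  exist _ (t : {ptws X -> R}) (mem_set tK).

Lemma realization_face K (t : X -> R) F : F \in K -> (forall x, 0 <= t x) ->
  \sum_x t x = 1 -> support t \subset F -> realization_set K t.
Proof. by move=> FK t0 t1 tF; split=> //; exact: faces_closed FK tF. Qed.

Lemma sum_indicator A (c : R) : \sum_x c * (x \in A)%:R = c * #|A|%:R.
Proof.
rewrite -mulr_sumr; congr (_ * _).
by rewrite -sum1_card natr_sum [RHS]big_mkcond; apply: eq_bigr => x _; case: (x \in A).
Qed.

Lemma sum_vertex p (c : R) : \sum_x c * (x == p)%:R = c.
Proof.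
rewrite (bigD1 p) //= eqxx mulr1 big1 ?addr0 // => x xp.
by rewrite (negPf xp) mulr0.
Qed.

Section ConeStep.
Variables (K : complex X) (sigma : {set X}) (p s0 : X).
Hypotheses (cK : cone_link K sigma p) (s0_in : s0 \in sigma).

(** Mass is transferred from [sigma] to the apex [p] until a vertex of [sigma]
    is exhausted; off the star of [sigma] nothing moves. *)
Definition push (t : X -> R) (s : R) (x : X) : R :=
  t x - s * least s0 sigma t * (x \in sigma)%:R
  + s * least s0 sigma t * #|sigma|%:R * (x == p)%:R.

Lemma push0 t : push t 0 = t.
Proof. by apply/funext => x; rewrite /push !mul0r subr0 addr0. Qed.

Lemma push_least0 t s : least s0 sigma t = 0 -> push t s = t.
Proof. by move=> t0; apply/funext => x; rewrite /push t0 mulr0 !mul0r subr0 addr0. Qed.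

Lemma push_ge0 t s x : 0 <= s <= 1 -> (forall x, 0 <= t x) -> 0 <= push t s x.
Proof.
move=> /andP[s_0 s_1] t0; have l0 : 0 <= least s0 sigma t by apply: least_ge0.
apply: addr_ge0; last by rewrite !mulr_ge0.
rewrite subr_ge0; have [xs|_] := boolP (x \in sigma); last by rewrite mulr0.
rewrite mulr1; apply: le_trans (least_le s0 t xs).
by rewrite -[leRHS]mul1r ler_wpM2r.
Qed.

Lemma push_sum t s : \sum_x push t s x = \sum_x t x.
Proof. by rewrite big_split sumrB /= sum_indicator sum_vertex subrK. Qed.

Lemma least_gt0 t : (forall x, 0 <= t x) -> least s0 sigma t != 0 ->
  sigma \subset support t.
Proof.
move=> t0 l0; apply/subsetP => x xs; rewrite inE.
apply: contraNneq l0 => tx; rewrite eq_le least_ge0 // andbT.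
by rewrite -tx least_le.
Qed.

Lemma push_in t s : 0 <= s <= 1 -> realization_set K t ->
  realization_set K (push t s).
Proof.
move=> s01 [t0 t1 tK]; have [l0|l0] := eqVneq (least s0 sigma t) 0.
  by rewrite push_least0.
have [_ /(_ _ tK (least_gt0 t0 l0)) pK] := cK.
apply: (realization_face pK) => [x||]; [exact: push_ge0|by rewrite push_sum|].
apply/subsetP => x; rewrite !inE; apply: contraNT; rewrite negb_or negbK => /andP[xp /eqP tx].
have xs : x \notin sigma.
  by apply: contraTN (least_gt0 t0 l0) => xs; apply/subsetPn; exists x; rewrite // inE tx eqxx.
by rewrite /push tx (negPf xp) (negPf xs) !mulr0 subr0 addr0.
Qed.

Lemma push1_in t : realization_set K t ->
  realization_set (delete_star K sigma) (push t 1).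
Proof.
move=> tK; have s01 : 0 <= (1 : R) <= 1 by rewrite ler01 lexx.
have [p0 p1 pK] := push_in s01 tK; split=> //.
rewrite -[_ \in _]/(_ \in delete_star K sigma) in_delete_star pK /=.
apply/subsetPn; have [x xs lx] := least_attained t s0_in; exists x => //.
have xp : x != p by apply: contraNneq cK.1 => <-.
by rewrite inE negbK /push lx xs (negPf xp) mulr0 mul1r mulr1 subrr addr0.
Qed.

Lemma delete_star_in (t : {ptws X -> R}) : realization_set (delete_star K sigma) t ->
  realization_set K t.
Proof. by case=> t0 t1; rewrite inE => /andP[]. Qed.

Lemma continuous_push_coord (T : topologicalType) (f : T -> X -> R) (s : T -> R) x :
  (forall y, continuous (f^~ y)) -> continuous s ->
  continuous (fun u => push (f u) (s u) x).
Proof.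
move=> cf cs; have cl : continuous (fun u => s u * least s0 sigma (f u)).
  by apply: continuous_mulr => //; exact: continuous_least.
apply: continuous_addr.
  by apply: continuous_subr; [exact: cf|apply: continuous_mulr => //; exact: continuous_cstr].
apply: continuous_mulr; last exact: continuous_cstr.
by apply: continuous_mulr; [exact: cl|exact: continuous_cstr].
Qed.

(** The push at time 1 retracts [K] onto the complement of the open star, and the
    pushes at earlier times join it to the identity. *)
Lemma cone_equivalent :
  homotopy_equivalent R (realization R K) (realization R (delete_star K sigma)).
Proof.
pose f (t : realization R K) := mk_point (push1_in (realizationP t)).
pose g (t : realization R (delete_star K sigma)) :=
  mk_point (delete_star_in (realizationP t)).
have time (s : R) : 0 <= 1 - clamp s <= 1.
  by rewrite subr_ge0 clamp_le1 lerBlDr lerDl clamp_ge0.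
pose h (q : realization R K * R) := mk_point (push_in (time q.2) (realizationP q.1)).
exists f, g; split.
- apply: continuous_into => x; apply: continuous_push_coord; last exact: continuous_cstr.
  by move=> y; exact: continuous_coord.
- by apply: continuous_into => x; exact: continuous_coord.
- apply/homotopicP; exists h; split=> [|t|t].
  + apply: continuous_into => x; apply: continuous_push_coord.
      by move=> y; exact: (continuous_comp_fun (@continuous_fst _ _) (@continuous_coord _ _ _ y)).
    apply: continuous_subr; first exact: continuous_cstr.
    exact: (continuous_comp_fun (@continuous_snd _ _) (@continuous_clamp R)).
  + by apply: val_inj; rewrite /= clamp0 subr0.
  + by apply: val_inj; rewrite /= clamp1 subrr push0.
- have -> : f \o g = id; last by apply: homotopic_refl => t; exact: cvg_id.
  apply/funext => t; apply: val_inj => /=; apply: push_least0.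
  have := support_face t; rewrite in_delete_star => /andP[_].
  by apply: contraNeq; apply: least_gt0; exact: coord_ge0.
Qed.

End ConeStep.

(** Straight-line contraction to the apex. *)
Lemma cone_contractible K p : cone_link K set0 p -> set0 \in K ->
  contractible R (realization R K).
Proof.
move=> [_ cone] K0; pose e x : R := (x == p)%:R.
have e_ge0 x : 0 <= e x by rewrite ler0n.
have e_sum : \sum_x e x = 1.
  by rewrite -[RHS](sum_vertex p 1); apply: eq_bigr => x _; rewrite mul1r.
have eP : realization_set K e.
  apply: (realization_face (cone _ K0 (subxx _))) => //.
  by apply/subsetP => x; rewrite !inE pnatr_eq0 eqb0 negbK => ->.
have hP (q : realization R K * R) : realization_set K
    (fun x => (1 - clamp q.2) * val q.1 x + clamp q.2 * e x).
  have FK := cone _ (support_face q.1) (sub0set _).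
  apply: (realization_face FK) => [x||].
  - by rewrite addr_ge0 // mulr_ge0 ?subr_ge0 ?clamp_le1 ?clamp_ge0 ?coord_ge0.
  - by rewrite big_split /= -!mulr_sumr coord_sum e_sum !mulr1 subrK.
  - apply/subsetP => x; rewrite !inE; apply: contraNT; rewrite negb_or negbK => /andP[xp /eqP ->].
    by rewrite /e (negPf xp) !mulr0 addr0.
exists (mk_point eP); apply/homotopicP; exists (fun q => mk_point (hP q)).
split=> [|t|t].
- apply: continuous_into => x /=.
  have cc : continuous (fun q : realization R K * R => clamp q.2).
    exact: (continuous_comp_fun (@continuous_snd _ _) (@continuous_clamp R)).
  apply: continuous_addr; apply: continuous_mulr => //; last exact: continuous_cstr.
    by apply: continuous_subr => //; exact: continuous_cstr.
  exact: (continuous_comp_fun (@continuous_fst _ _) (@continuous_coord _ _ _ x)).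
- by apply: val_inj; apply/funext => x; rewrite /= clamp0 subr0 mul1r mul0r addr0.
- by apply: val_inj; apply/funext => x; rewrite /= clamp1 subrr mul1r mul0r add0r.
Qed.

Lemma collapses_sub K L F : collapses K L -> F \in L -> F \in K.
Proof.
elim=> // {}K {}L sigma p _ _ IH /IH.
by rewrite in_delete_star => /andP[].
Qed.

Lemma nonvoid_delete_star K sigma : set0 \in delete_star K sigma ->
  exists s0, s0 \in sigma.
Proof. by rewrite in_delete_star subset0 => /andP[_ /set0Pn]. Qed.

(** Since [L] is not void, no step of the collapse has an empty [sigma], the case
    in which the homotopy type changes. *)
Lemma collapses_equivalent K L : collapses K L -> set0 \in L ->
  homotopy_equivalent R (realization R K) (realization R L).
Proof.
elim=> [{}K _|{}K {}L sigma p cK KL IH L0]; first exact: homotopy_equivalent_refl.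
have [s0 s0s] := nonvoid_delete_star (collapses_sub KL L0).
by apply: homotopy_equivalent_trans (IH L0); apply: cone_equivalent cK s0s.
Qed.

(** Here the last effective step has an empty [sigma]; it is taken from a complex
    that is a cone. *)
Lemma collapses_contractible K : collapses K void_complex -> set0 \in K ->
  contractible R (realization R K).
Proof.
move=> cK; move E: void_complex cK => V cK.
elim: cK E => [{}K <-|{}K L sigma p cK KL IH LE K0]; first by rewrite inE.
have [s0|/set0Pn[s0 s0s]] := eqVneq sigma set0.
  by rewrite s0 in cK; exact: cone_contractible cK K0.
apply: contractible_equivalent (cone_equivalent cK s0s) (IH LE _).
by rewrite in_delete_star K0 subset0; apply/set0Pn; exists s0.
Qed.

End Realization.
(** * The join of two boundaries of simplices is a sphere *)

Section JoinSphere.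
Variables (R : realType) (X : finType) (A : {set X}) (a b : X) (k : nat).
Variable iota : 'I_k.+1 -> X.
Hypotheses (aA : a \in A) (bA : b \notin A) (iota_inj : injective iota).
Hypotheses (iota_a : forall i, iota i != a) (iota_b : forall i, iota i != b).
Hypothesis iota_onto : forall x, x != a -> x != b -> exists i, iota i = x.
Implicit Types (t w : X -> R) (x : X) (i : 'I_k.+1).

(** The join of the boundaries of the simplices on [A] and on its complement is
    realized by the points that have a zero coordinate on each side. Up to positive
    factors, these are representatives of the non-zero vectors of [X -> R] modulo
    functions constant on both sides. Such a class has two normal forms: the one
    with minimum zero on both sides and total mass one, a point of the join, and
    the one that vanishes at [a] and [b] and has Euclidean norm one, a point of the
    sphere in the other coordinates. *)
Definition join_set : set {ptws X -> R} :=
  [set t | [/\ forall x, 0 <= t x, \sum_x t x = 1,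
     exists2 x, x \in A & t x = 0 & exists2 x, x \notin A & t x = 0]]%classic.

Definition join : topologicalType := classical_sets.set_type join_set.

Lemma joinP (t : join) : join_set (val t).
Proof. exact: set_mem (valP t). Qed.

Definition mk_join t (tJ : join_set t) : join :=
  exist _ (t : {ptws X -> R}) (mem_set tJ).

Let base x := if x \in A then a else b.

(** Subtracting [floor t] brings the minima on both sides to zero. *)
Definition floor t x := if x \in A then least a A t else least b (~: A) t.

Definition ground t x := t x - floor t x.

Definition normalize t x := t x / \sum_y t y.

Let bA' : b \in ~: A. Proof. by rewrite inE. Qed.

Lemma ground_ge0 t x : 0 <= ground t x.
Proof.
rewrite /ground /floor subr_ge0; have [xA|xA] := boolP (x \in A).
  exact: least_le.
by apply: least_le; rewrite inE.
Qed.

Lemma ground_zero t : (exists2 x, x \in A & ground t x = 0) /\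
  (exists2 x, x \notin A & ground t x = 0).
Proof.
rewrite /ground /floor; split.
  by have [x xA ->] := least_attained t aA; exists x; rewrite // xA subrr.
have [x xA ->] := least_attained t bA'; exists x; first by rewrite inE in xA.
by rewrite inE in xA; rewrite (negPf xA) subrr.
Qed.

Lemma sum_ground_eq0 t : \sum_x ground t x = 0 -> forall x, t x = t (base x).
Proof.
move=> /eqP; rewrite psumr_eq0 => [/allP t0|x _]; last exact: ground_ge0.
have tE x : t x = floor t x.
  by apply/eqP; rewrite -subr_eq0; have := t0 x; rewrite mem_index_enum => /(_ isT).
move=> x; rewrite (tE x) (tE (base x)) /base /floor.
by have [xA|xA] := boolP (x \in A); rewrite ?aA ?(negPf bA).
Qed.

Lemma join_normalize t : (forall x, 0 <= t x) -> \sum_x t x != 0 ->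
  (exists2 x, x \in A & t x = 0) -> (exists2 x, x \notin A & t x = 0) ->
  join_set (normalize t).
Proof.
move=> t0 s0 [x xA tx] [y yA ty]; rewrite /normalize; split.
- by move=> z; rewrite divr_ge0 // sumr_ge0.
- by rewrite -mulr_suml mulfV.
- by exists x; rewrite // tx mul0r.
- by exists y; rewrite // ty mul0r.
Qed.

Definition extend (u : 'I_k.+1 -> R) x : R := \sum_i u i * (iota i == x)%:R.

Lemma extend_iota u i : extend u (iota i) = u i.
Proof.
rewrite /extend (bigD1 i) //= eqxx mulr1 big1 ?addr0 // => j ji.
by rewrite (inj_eq iota_inj) (negPf ji) mulr0.
Qed.

Lemma extend_base u x : extend u (base x) = 0.
Proof.
rewrite /extend big1 // => i _; rewrite /base.
by case: ifP => _; rewrite ?(negPf (iota_a i)) ?(negPf (iota_b i)) mulr0.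
Qed.

Lemma sphereP (u : sphere R k) : \sum_i val u i ^+ 2 = 1.
Proof. exact: set_mem (valP u). Qed.

Lemma sum_ground_extend (u : sphere R k) : \sum_x ground (extend (val u)) x != 0.
Proof.
apply/eqP => /sum_ground_eq0 u0; have := sphereP u.
rewrite big1 ?(eq_sym 0) => [/eqP|i _]; first by rewrite eq_sym oner_eq0.
by rewrite -extend_iota u0 extend_base expr0n.
Qed.

Definition to_join (u : sphere R k) : join :=
  let: conj zA zC := ground_zero (extend (val u)) in
  mk_join (join_normalize (ground_ge0 _) (sum_ground_extend u) zA zC).

Lemma to_joinE u : val (to_join u) = normalize (ground (extend (val u))).
Proof. by rewrite /to_join; case: (ground_zero _). Qed.

Definition slope t i : R := t (iota i) - t (base (iota i)).

Definition slope_norm t : R := Num.sqrt (\sum_i slope t i ^+ 2).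

Lemma slope_norm_neq0 t : join_set t -> slope_norm t != 0.
Proof.
move=> [t0 t1 [x xA tx] [y yA ty]]; rewrite sqrtr_eq0 -ltNge lt_neqAle.
rewrite sumr_ge0 ?andbT => [|i _]; last exact: sqr_ge0.
apply/eqP => /esym/eqP; rewrite psumr_eq0 => [/allP s0|i _]; last exact: sqr_ge0.
have tb z : t z = t (base z).
  have [->|za] := eqVneq z a; first by rewrite /base aA.
  have [->|zb] := eqVneq z b; first by rewrite /base (negPf bA).
  have [i <-] := iota_onto za zb; apply/eqP; rewrite -subr_eq0.
  by have := s0 i; rewrite mem_index_enum sqrf_eq0 => /(_ isT).
have ta : t a = 0 by rewrite -tx (tb x) /base xA.
have tb' : t b = 0 by rewrite -ty (tb y) /base (negPf yA).
have := t1; rewrite big1 => [/esym/eqP|z _]; first by rewrite oner_eq0.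
by rewrite tb /base; case: ifP.
Qed.

Lemma slope_sphere t : join_set t ->
  @sphere_set R k (fun i => slope t i / slope_norm t).
Proof.
move=> tJ; rewrite /sphere_set /=.
rewrite (eq_bigr (fun i => slope t i ^+ 2 / slope_norm t ^+ 2)) => [|i _]; last first.
  by rewrite expr_div_n.
rewrite -mulr_suml /slope_norm sqr_sqrtr ?sumr_ge0 // => [|i _]; last exact: sqr_ge0.
rewrite mulfV //; have := slope_norm_neq0 tJ; rewrite sqrtr_eq0 -ltNge => lt.
by rewrite gt_eqF.
Qed.

Definition to_sphere (t : join) : sphere R k :=
  exist _ ((fun i => slope (val t) i / slope_norm (val t)) : {ptws 'I_k.+1 -> R})
    (mem_set (slope_sphere (joinP t))).

Lemma to_joinK : cancel to_join to_sphere.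
Proof.
move=> u; apply: val_inj; apply/funext => i; rewrite /to_sphere /= to_joinE.
set S := \sum_x ground (extend (val u)) x.
have S0 : 0 < S.
  by rewrite lt_neqAle eq_sym sum_ground_extend sumr_ge0 // => x _; exact: ground_ge0.
have slE j : slope (normalize (ground (extend (val u)))) j = S^-1 * val u j.
  rewrite /slope /normalize -/S -mulrBl mulrC; congr (_ * _).
  rewrite /ground extend_iota extend_base.
  have -> : floor (extend (val u)) (base (iota j)) = floor (extend (val u)) (iota j).
    by rewrite /floor /base; have [jA|jA] := boolP (iota j \in A); rewrite ?aA ?(negPf bA).
  by rewrite sub0r opprK subrK.
have -> : slope_norm (normalize (ground (extend (val u)))) = S^-1.
  rewrite /slope_norm (eq_bigr (fun j => S^-1 ^+ 2 * val u j ^+ 2)) => [|j _].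
    by rewrite -mulr_sumr sphereP mulr1 sqrtr_sqr ger0_norm // invr_ge0 ltW.
  by rewrite slE exprMn.
by rewrite slE mulrAC mulfV ?mul1r // invr_eq0 gt_eqF.
Qed.

Lemma to_sphereK : cancel to_sphere to_join.
Proof.
move=> t; apply: val_inj; rewrite to_joinE /=; have tJ := joinP t.
set n := slope_norm (val t); have n0 : n != 0 by exact: slope_norm_neq0.
have n_gt0 : 0 < n by rewrite lt_neqAle eq_sym n0 sqrtr_ge0.
have exE x : extend (fun i => slope (val t) i / n) x = (val t x - val t (base x)) / n.
  have [->|xa] := eqVneq x a.
    by have := extend_base (fun i => slope (val t) i / n) a; rewrite /base aA subrr mul0r.
  have [->|xb] := eqVneq x b.
    by have := extend_base (fun i => slope (val t) i / n) b; rewrite /base (negPf bA) subrr mul0r.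
  by have [i <-] := iota_onto xa xb; rewrite extend_iota.
have [t0 t1 [x xA tx] [y yA ty]] := tJ.
have flE z : floor (extend (fun i => slope (val t) i / n)) z = - val t (base z) / n.
  rewrite /floor; case: ifP => zA.
    rewrite (least_eq aA xA) => [|w wA]; first by rewrite exE /base xA zA tx sub0r.
    rewrite !exE /base wA xA tx sub0r.
    by rewrite ler_pM2r ?invr_gt0 // lerBrDl subrr.
  have yC : y \in ~: A by rewrite inE.
  rewrite (least_eq bA' yC) => [|w]; first by rewrite exE /base (negPf yA) zA ty sub0r.
  rewrite inE => wA; rewrite !exE /base (negPf wA) (negPf yA) ty sub0r.
  by rewrite ler_pM2r ?invr_gt0 // lerBrDl subrr.
have grE z : ground (extend (fun i => slope (val t) i / n)) z = val t z / n.
  by rewrite /ground flE exE -mulrBl opprK subrK.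
apply/funext => z; rewrite /normalize grE (eq_bigr (fun z => val t z / n)) => [|w _].
  by rewrite -mulr_suml t1 mul1r invrK mulfVK.
exact: grE.
Qed.

Lemma continuous_ground (T : topologicalType) (f : T -> X -> R) x :
  (forall y, continuous (f^~ y)) -> continuous (fun u => ground (f u) x).
Proof.
move=> cf; apply: continuous_subr => //; rewrite /floor.
by case: (x \in A); exact: continuous_least.
Qed.

Lemma continuous_normalize (T : topologicalType) (f : T -> X -> R) x :
  (forall y, continuous (f^~ y)) -> (forall u, \sum_y f u y != 0) ->
  continuous (fun u => normalize (f u) x).
Proof.
by move=> cf f0; apply: continuous_divr => //; exact: continuous_sum.
Qed.

Lemma continuous_to_join : continuous to_join.
Proof.
apply: continuous_into => x.
have -> : (fun u => val (to_join u) x) =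
    (fun u => normalize (ground (extend (val u))) x).
  by apply/funext => u; rewrite to_joinE.
apply: continuous_normalize; last exact: sum_ground_extend.
move=> y; apply: continuous_ground => z; apply: continuous_sum => i.
apply: continuous_mulr; last exact: continuous_cstr.
exact: continuous_coord.
Qed.

Lemma continuous_to_sphere : continuous to_sphere.
Proof.
have cs i : continuous (fun t : join => slope (val t) i).
  by apply: continuous_subr; exact: continuous_coord.
apply: continuous_into => i /=; apply: continuous_divr => //.
  apply: (@continuous_comp_fun _ _ _ (fun t : join => \sum_i slope (val t) i ^+ 2)).
    by apply: continuous_sum => j; apply: continuous_mulr.
  exact: sqrt_continuous.
by move=> t; exact: slope_norm_neq0 (joinP t).
Qed.

Lemma to_join_base x : val (to_join (sphere_base R k)) x = (x == iota ord0)%:R.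
Proof.
rewrite to_joinE; have exE z : extend (val (sphere_base R k)) z = (z == iota ord0)%:R.
  rewrite /extend (bigD1 ord0) //= mul1r big1 ?addr0 => [|i i0]; first by rewrite eq_sym.
  by rewrite (negPf i0) mul0r.
have flE z : floor (extend (val (sphere_base R k))) z = 0.
  rewrite /floor; case: ifP => _.
    rewrite (least_eq aA aA) => [|w _]; rewrite !exE eq_sym (negPf (iota_a _)) //.
  rewrite (least_eq bA' bA') => [|w _]; rewrite !exE eq_sym (negPf (iota_b _)) //.
have grE z : ground (extend (val (sphere_base R k))) z = (z == iota ord0)%:R.
  by rewrite /ground flE subr0.
rewrite /normalize grE (eq_bigr (fun z => 1 * (z == iota ord0)%:R)) => [|z _].
  by rewrite sum_vertex divr1.
by rewrite grE mul1r.
Qed.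

End JoinSphere.

(** The sphere has one coordinate for every vertex other than [a] and [b]; placing
    [y0] first makes it correspond to the base point. *)
Lemma join_sphere_homeo (R : realType) (X : finType) (A : {set X}) (a b y0 : X) k :
  a \in A -> b \notin A -> y0 \in A -> y0 != a -> #|X| = k.+3 ->
  exists (Phi : sphere R k -> join R A) (Theta : join R A -> sphere R k),
  [/\ continuous Phi, continuous Theta, cancel Phi Theta, cancel Theta Phi &
      forall x, val (Phi (sphere_base R k)) x = (x == y0)%:R].
Proof.
move=> aA bA yA ya cardX; have yb : y0 != b by apply: contraNneq bA => <-.
have ab : a != b by apply: contraNneq bA => <-.
pose s := y0 :: enum (~: [set a; b; y0]).
have size_s : size s = k.+1.
  rewrite /= -cardE cardsCs setCK cardX setUC cardsU1 cards2 ab !inE.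
  by rewrite (negPf ya) (negPf yb) !subSS subn0.
have s_uniq : uniq s by rewrite /= enum_uniq mem_enum !inE eqxx orbT.
have sP x : (x \in s) = (x != a) && (x != b).
  rewrite inE mem_enum !inE; case: eqVneq => [->|_]; first by rewrite ya yb.
  by rewrite orbF negb_or.
pose iota (i : 'I_k.+1) := nth y0 s i.
have iotaP i : (iota i != a) && (iota i != b) by rewrite -sP mem_nth ?size_s.
have iota_a i : iota i != a by case/andP: (iotaP i).
have iota_b i : iota i != b by case/andP: (iotaP i).
have iota_inj : injective iota.
  by move=> i j /eqP; rewrite nth_uniq ?size_s // => /eqP/val_inj.
have iota_onto x : x != a -> x != b -> exists i, iota i = x.
  move=> xa xb; have xs : x \in s by rewrite sP xa.
  have ix : (index x s < k.+1)%N by rewrite -size_s index_mem.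
  by exists (Ordinal ix); rewrite /iota nth_index.
exists (to_join aA bA iota_inj iota_a iota_b), (to_sphere aA bA iota_onto); split.
- exact: continuous_to_join.
- exact: continuous_to_sphere.
- exact: to_joinK.
- exact: to_sphereK.
- by move=> x; rewrite to_join_base.
Qed.
(** * The dual of a disjoint union of cliques is a wedge of spheres *)

Lemma closed_sphere_base (R : realType) k : closed [set sphere_base R k]%classic.
Proof.
pose b := sphere_base R k; pose dist (u : sphere R k) := \sum_j (val u j - val b j) ^+ 2.
have -> : [set b]%classic = (dist @^-1` [set 0])%classic.
  apply/seteqP; split=> [u ->|u /= /eqP] /=.
    by rewrite /dist big1 // => j _; rewrite subrr expr0n.
  rewrite psumr_eq0 => [/allP u0|j _]; last exact: sqr_ge0.
  apply: val_inj; apply/funext => j; apply/eqP; rewrite -subr_eq0.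
  by have := u0 j; rewrite mem_index_enum sqrf_eq0 => /(_ isT).
apply: preimage_closed; last exact: closed_eq.
have cu j : continuous (fun u : sphere R k => val u j - val b j).
  by apply: continuous_subr; [exact: continuous_coord|exact: continuous_cstr].
by move=> u _; apply: continuous_sum => j; exact: continuous_mulr.
Qed.

(** Every class other than that of [y0] contributes a sphere, the join of the
    boundaries of the simplices on the class and on its complement [other i]. The
    spheres all pass through the vertex [y0], and a point of the dual outside the
    star of [y0] lies on exactly one of them. The vertices [far i] ensure that the
    simplex on [other i] has other vertices than [y0]. *)
Section WedgeOfJoins.
Variables (R : realType) (X : finType) (c : rel X) (y0 : X) (k n : nat).
Variables (rep far : 'I_n.+1 -> X).
Hypotheses (c_refl : reflexive c) (c_sym : symmetric c) (c_trans : transitive c).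
Hypothesis rep_far : forall i, ~~ c y0 (rep i).
Hypothesis rep_inj : forall i j, c (rep i) (rep j) -> i = j.
Hypothesis rep_cover : forall x, ~~ c y0 x -> exists i, c (rep i) x.
Hypothesis far_y0 : forall i, far i != y0.
Hypothesis far_rep : forall i, ~~ c (rep i) (far i).
Implicit Types (i j : 'I_n.+1) (t w : X -> R) (x z : X) (s : R).

Let D := clique_dual c.

Definition other i : {set X} := [set x | ~~ c (rep i) x].

Let opp i := opposite c y0 (rep i).

Let y0_other i : y0 \in other i.
Proof. by rewrite inE c_sym rep_far. Qed.

Let rep_other i : rep i \notin other i.
Proof. by rewrite inE negbK c_refl. Qed.

Let in_opp i x : (x \in opp i) = (x != y0) && (x \in other i).
Proof. by rewrite in_opposite inE. Qed.

Let far_opp i : far i \in opp i.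
Proof. by rewrite in_opp far_y0 inE far_rep. Qed.

(** Positive exactly when [t] lies outside the star of [y0] on the i-th sphere,
    for a point [t] of the dual. *)
Definition height i t : R := least (far i) (opp i) t.

Definition weighted (a d : R) t x : R := a * t x + d * (x == y0)%:R.

Definition cut i w x : R := w x - least y0 (other i) w * (x \in other i)%:R.

(** Vectors modulo functions constant on [other i] and on its complement describe
    the i-th sphere. In this quotient the slide mixes [t] with the vertex [y0]. The
    antipode of [y0] is the barycentre of [opp i], the only point where the height
    reaches [1 / #|opp i|]; the weight of [y0] vanishes there, so that the mixture
    is never zero. At time 1 every point of height 0 has arrived at [y0]. *)
Definition slide i s t : X -> R := normalize (cut i
  (weighted (1 - s + s * height i t) (s * (1 - #|opp i|%:R * height i t)) t)).

Section Slide.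
Variables (i : 'I_n.+1) (s : R) (t : X -> R).
Hypotheses (s01 : 0 <= s <= 1) (t0 : forall x, 0 <= t x) (t1 : \sum_x t x = 1).

Lemma height_ge0 : 0 <= height i t.
Proof. by apply: least_ge0. Qed.

Lemma height_mul_le1 : #|opp i|%:R * height i t <= 1.
Proof.
rewrite -[leRHS]t1 mulrC -sum_indicator; apply: ler_sum => x _.
have [xo|_] := boolP (x \in opp i); last by rewrite mulr0.
by rewrite mulr1 least_le.
Qed.

Let a := 1 - s + s * height i t.
Let d := s * (1 - #|opp i|%:R * height i t).
Let w := weighted a d t.

Lemma slide_a_ge0 : 0 <= a.
Proof.
case/andP: s01 => s_0 s_1; apply: addr_ge0; first by rewrite subr_ge0.
by rewrite mulr_ge0 // height_ge0.
Qed.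

Lemma slide_d_ge0 : 0 <= d.
Proof. by case/andP: s01 => s_0 s_1; rewrite mulr_ge0 // subr_ge0 height_mul_le1. Qed.

Lemma weighted_ge0 x : 0 <= w x.
Proof.
apply: addr_ge0; first by rewrite mulr_ge0 // slide_a_ge0.
by rewrite mulr_ge0 // slide_d_ge0.
Qed.

Lemma cut_ge0 x : 0 <= cut i w x.
Proof.
rewrite subr_ge0; have [xo|_] := boolP (x \in other i).
  by rewrite mulr1 least_le.
by rewrite mulr0 weighted_ge0.
Qed.

Lemma cut_zero : exists2 x, x \in other i & cut i w x = 0.
Proof.
have [x xo lx] := least_attained w (y0_other i); exists x => //.
by rewrite /cut lx xo mulr1 subrr.
Qed.

Lemma height0_cut : height i t = 0 -> cut i w = w.
Proof.
move=> h0; have [x xo tx] := least_attained t (far_opp i).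
rewrite -/(height i t) h0 in tx; move: xo; rewrite in_opp => /andP[xy xo].
apply/funext => z; rewrite /cut; have -> : least y0 (other i) w = 0; last first.
  by rewrite mul0r subr0.
have wx : w x = 0 by rewrite /w /weighted -tx (negPf xy) !mulr0 addr0.
by rewrite (least_eq (y0_other i) xo) // => z' _; rewrite wx weighted_ge0.
Qed.

Lemma height0_weighted x : height i t = 0 -> w x = (1 - s) * t x + s * (x == y0)%:R.
Proof. by move=> h0; rewrite /w /weighted /a /d h0 !mulr0 addr0 subr0 mulr1. Qed.

Lemma height0_sum : height i t = 0 -> \sum_x w x = 1.
Proof.
move=> h0; rewrite (eq_bigr _ (fun x _ => height0_weighted x h0)).
by rewrite big_split /= -mulr_sumr t1 sum_vertex mulr1 subrK.
Qed.

Lemma height0_slide x : height i t = 0 ->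
  slide i s t x = (1 - s) * t x + s * (x == y0)%:R.
Proof.
move=> h0; rewrite /slide -/a -/d -/w height0_cut // /normalize height0_sum // divr1.
exact: height0_weighted.
Qed.

(** Satisfied by the points of the dual and by those of the i-th sphere. *)
Definition regular : Prop := height i t = 0 \/
  t y0 = 0 /\ exists2 z, z \notin other i & t z = 0.

(** If the cut vector vanished, the mixture would be constant on [other i] and zero
    outside, which makes [t] the barycentre of [opp i]; but there [d] is zero. *)
Lemma sum_cut : regular -> \sum_x cut i w x != 0.
Proof.
have [h0 _|h0] := eqVneq (height i t) 0.
  by rewrite height0_cut // height0_sum // oner_eq0.
case=> [h0'|[ty _]]; first by rewrite h0' eqxx in h0.
have h_gt0 : 0 < height i t by rewrite lt_neqAle eq_sym h0 height_ge0.
apply/eqP => /eqP; rewrite psumr_eq0 => [/allP cut0|x _]; last exact: cut_ge0.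
have {}cut0 x : w x = least y0 (other i) w * (x \in other i)%:R.
  by apply/eqP; rewrite -subr_eq0; have := cut0 x; rewrite mem_index_enum => /(_ isT).
have a_gt0 : 0 < a.
  have /andP[s_0 s_1] := s01; rewrite /a; move: s_0; rewrite le_eqVlt => /predU1P[<-|s_0].
    by rewrite mul0r addr0 subr0.
  by rewrite ltr_wpDl ?subr_ge0 // mulr_gt0.
have least_d : least y0 (other i) w = d.
  by have := cut0 y0; rewrite y0_other mulr1 /w /weighted ty mulr0 add0r eqxx mulr1.
have at_ x : a * t x = d * (x \in opp i)%:R.
  have [->|xy] := eqVneq x y0; first by rewrite ty in_opp eqxx !mulr0.
  by have := cut0 x; rewrite least_d /w /weighted (negPf xy) mulr0 addr0 in_opp xy.
have a_nd : a = d * #|opp i|%:R.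
  by rewrite -[LHS]mulr1 -[X in a * X]t1 mulr_sumr (eq_bigr _ (fun x _ => at_ x)) sum_indicator.
have ah : a * height i t = d.
  have [x xo hx] := least_attained t (far_opp i).
  by rewrite /height hx at_ xo mulr1.
have nh : #|opp i|%:R * height i t = 1.
  apply: (mulfI (lt0r_neq0 a_gt0)); rewrite mulr1 mulrCA ah [RHS]a_nd mulrC //.
by have := a_gt0; rewrite a_nd /d nh subrr mulr0 mul0r ltxx.
Qed.

Lemma slide_sum : regular -> \sum_x slide i s t x = 1.
Proof. by move=> reg; rewrite /slide /normalize -mulr_suml mulfV // sum_cut. Qed.

Lemma slide_ge0 x : 0 <= slide i s t x.
Proof. by rewrite divr_ge0 ?sumr_ge0 //; [|move=> z _]; exact: cut_ge0. Qed.

Lemma slide_zero : exists2 x, x \in other i & slide i s t x = 0.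
Proof.
by have [x xo cx] := cut_zero; exists x; rewrite // /slide /normalize cx mul0r.
Qed.

Lemma slide_zeroC z : z \notin other i -> a * t z = 0 -> slide i s t z = 0.
Proof.
move=> zo az; rewrite /slide /normalize /cut (negPf zo) mulr0 subr0.
have zy : z != y0 by apply: contraNneq zo => ->.
by rewrite /weighted az (negPf zy) mulr0 addr0 mul0r.
Qed.

Lemma slide_join z : regular -> z \notin other i -> a * t z = 0 ->
  join_set (other i) (slide i s t).
Proof.
move=> reg zo az; split; [exact: slide_ge0|exact: slide_sum|exact: slide_zero|].
by exists z => //; exact: slide_zeroC.
Qed.

End Slide.

Lemma slide0 i t : (forall x, 0 <= t x) -> \sum_x t x = 1 -> regular i t ->
  slide i 0 t = t.
Proof.
move=> t0 t1 reg; have wE : weighted (1 - 0 + 0 * height i t)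
    (0 * (1 - #|opp i|%:R * height i t)) t = t.
  by apply/funext => x; rewrite /weighted !mul0r subr0 !addr0 mul1r.
rewrite /slide wE; have -> : cut i t = t.
  apply/funext => x; rewrite /cut; suff -> : least y0 (other i) t = 0 by rewrite mul0r subr0.
  case: reg => [h0|[ty _]]; last by rewrite (least_eq (y0_other i) (y0_other i)) ?ty.
  have [z zo hz] := least_attained t (far_opp i).
  rewrite -/(height i t) h0 in hz; move: zo; rewrite in_opp => /andP[_ zo].
  by rewrite (least_eq (y0_other i) zo) -?hz.
by apply/funext => x; rewrite /normalize t1 divr1.
Qed.

Lemma height_vertex i : height i (fun x => (x == y0)%:R) = 0.
Proof.
rewrite /height (least_eq (far_opp i) (far_opp i)) => [|x _]; rewrite (negPf (far_y0 i)) //.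
Qed.

Lemma slide_vertex i s x : 0 <= s <= 1 ->
  slide i s (fun x => (x == y0)%:R) x = (x == y0)%:R.
Proof.
move=> s01; have v1 : \sum_x (x == y0)%:R = 1 :> R.
  by rewrite -[RHS](sum_vertex y0 1); apply: eq_bigr => z _; rewrite mul1r.
rewrite height0_slide ?height_vertex //.
by rewrite -mulrDl subrK mul1r.
Qed.

Section DualPoints.
Variable t : X -> R.
Hypothesis tD : realization_set D t.

Let t0 x : 0 <= t x. Proof. by have [] := tD. Qed.
Let t1 : \sum_x t x = 1. Proof. by have [] := tD. Qed.
Let tF : support t \in D. Proof. by have [] := tD. Qed.

Lemma height_opp i : height i t != 0 -> opp i \subset support t.
Proof. by move=> h0; apply: least_gt0 h0 => //; exact: far_opp. Qed.

Lemma dual_regular i : regular i t.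
Proof.
have [h0|h0] := eqVneq (height i t) 0; [by left|right].
have [yF [z zF rz]] := opposite_face c_refl c_sym c_trans tF (height_opp h0).
split; first by move: yF; rewrite inE negbK => /eqP.
by exists z; [rewrite inE negbK|move: zF; rewrite inE negbK => /eqP].
Qed.

Lemma height_unique i j : height i t != 0 -> height j t != 0 -> i = j.
Proof.
move=> hi hj; have [_ [z zF rz]] := opposite_face c_refl c_sym c_trans tF (height_opp hi).
apply: rep_inj; rewrite -[c _ _]negbK; apply: contra zF => nij.
apply: (subsetP (height_opp hj)); rewrite in_opposite; apply/andP; split.
  by apply: contraTneq rz => ->; rewrite c_sym rep_far.
by apply: contra nij => jz; apply: c_trans rz _; rewrite c_sym.
Qed.

(** For a point of the dual: it lies in the star of [y0] or on the i-th sphere. *)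
Definition isolated i : Prop := forall j, j != i -> height j t = 0.

Definition active : 'I_n.+1 := odflt ord0 [pick i | height i t != 0].

Lemma isolated_active : isolated active.
Proof.
rewrite /active => j; case: pickP => [i hi|h0 _] /=; last exact/eqP/negbFE/h0.
by apply: contraNeq => hj; rewrite (height_unique hj hi).
Qed.

Lemma height0_star : (forall i, height i t = 0) -> y0 |: support t \in D.
Proof.
move=> h0; apply/negPn/negP => nD.
have cover x : ~~ c y0 x -> exists2 r, r \in [set rep i | i in 'I_n.+1] & c r x.
  by move=> /rep_cover[i ix]; exists (rep i) => //; exact: imset_f.
have [_ /imsetP[i _ ->] iF] := star_or_opposite c_refl c_sym c_trans cover tF nD.
have [x xo hx] := least_attained t (far_opp i).
by have := subsetP iF x xo; rewrite inE -hx -/(height i t) h0 eqxx.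
Qed.

(** The slides along all spheres at once: at each point of the dual at most one
    of the terms of the sums is not zero. *)
Definition slide_all s : X -> R :=
  let w := weighted (1 - s + s * \sum_i height i t)
                    (s * (1 - \sum_i #|opp i|%:R * height i t)) t in
  normalize (fun x => w x - \sum_i least y0 (other i) w * (x \in other i)%:R).

Lemma slide_allE i s : 0 <= s <= 1 -> isolated i -> slide_all s = slide i s t.
Proof.
move=> s01 iso; rewrite /slide_all /slide (bigD1 i) //= big1 ?addr0 => [|j /iso->//].
rewrite (bigD1 i) //= big1 ?addr0 => [|j /iso->]; last by rewrite mulr0.
set w := weighted _ _ _; congr (normalize _); apply/funext => x.
rewrite /cut (bigD1 i) //= big1 ?addr0 // => j /iso h0.
have [z zo hz] := least_attained t (far_opp j).
rewrite -/(height j t) h0 in hz; move: zo; rewrite in_opp => /andP[zy zo].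
have wz : w z = 0 by rewrite /w /weighted -hz (negPf zy) !mulr0 addr0.
by rewrite (least_eq (y0_other j) zo) ?wz ?mul0r // => y _; exact: weighted_ge0.
Qed.

Lemma slide_all_in s : 0 <= s <= 1 -> realization_set D (slide_all s).
Proof.
move=> s01; set i := active; have iso : isolated i := isolated_active.
rewrite (slide_allE s01 iso); have reg := dual_regular i.
have [h0|h0] := eqVneq (height i t) 0.
  have all0 j : height j t = 0 by have [->//|/iso] := eqVneq j i.
  apply: (realization_face (height0_star all0)).
  - exact: slide_ge0.
  - exact: slide_sum.
  apply/subsetP => x; rewrite !inE height0_slide //.
  apply: contraNT; rewrite negb_or negbK => /andP[xy /eqP ->].
  by rewrite (negPf xy) !mulr0 addr0.
split; [exact: slide_ge0|exact: slide_sum|].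
rewrite -[_ \in _]/(_ \in D) in_clique_dual; apply/not_cliqueP.
have [x xo sx] := slide_zero i s t; case: reg => [h0'|[_ [z zo tz]]].
  by rewrite h0' eqxx in h0.
have sz : slide i s t z = 0 by apply: slide_zeroC; rewrite // tz mulr0.
exists x, z; rewrite !inE sx sz eqxx; split=> //.
  by apply: contraTneq xo => ->.
rewrite !inE negbK in xo zo *; apply: contra xo => xz.
by apply: c_trans zo _; rewrite c_sym.
Qed.

Lemma retract_in i : join_set (other i) (slide i 1 t).
Proof.
have s01 : 0 <= (1 : R) <= 1 by rewrite ler01 lexx.
have reg := dual_regular i; have [h0|h0] := eqVneq (height i t) 0.
  by apply: (slide_join s01 t0 t1 reg (rep_other i)); rewrite h0 mulr0 addr0 subrr mul0r.
case: (reg) => [h0'|[_ [z zo tz]]]; first by rewrite h0' eqxx in h0.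
by apply: (slide_join s01 t0 t1 reg zo); rewrite tz mulr0.
Qed.

End DualPoints.

Section JoinPoints.
Variables (i : 'I_n.+1) (t : {ptws X -> R}).
Hypothesis tJ : join_set (other i) t.

Lemma join_in : realization_set D t.
Proof.
have [t0 t1 [x xo tx] [z zo tz]] := tJ; split=> //.
rewrite -[_ \in _]/(_ \in D) in_clique_dual; apply/not_cliqueP.
exists x, z; rewrite !inE tx tz eqxx; split=> //.
  by apply: contraTneq xo => ->.
rewrite !inE negbK in xo zo *; apply: contra xo => xz.
by apply: c_trans zo _; rewrite c_sym.
Qed.

Lemma join_isolated : isolated t i.
Proof.
move=> j ji; apply/eqP/negPn/negP => /(height_opp join_in)/subsetP jF.
have [_ _ _ [z zo tz]] := tJ; have /negP : z \notin support t by rewrite inE tz eqxx.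
apply; apply: jF; rewrite in_opposite; rewrite inE negbK in zo.
apply/andP; split; first by apply: contraTneq zo => ->; rewrite c_sym rep_far.
apply: contra ji => jz; apply/eqP/rep_inj.
by apply: c_trans jz _; rewrite c_sym.
Qed.

Lemma slide_join_in s : 0 <= s <= 1 -> join_set (other i) (slide i s t).
Proof.
move=> s01; have [t0 t1 _ [z zo tz]] := tJ.
by apply: (slide_join s01 t0 t1 (dual_regular join_in i) zo); rewrite tz mulr0.
Qed.

End JoinPoints.

Lemma continuous_height (T : topologicalType) (f : T -> X -> R) i :
  (forall x, continuous (f^~ x)) -> continuous (fun u => height i (f u)).
Proof. exact: continuous_least. Qed.

Lemma continuous_weighted (T : topologicalType) (f : T -> X -> R) (a d : T -> R) x :
  continuous (f^~ x) -> continuous a -> continuous d ->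
  continuous (fun u => weighted (a u) (d u) (f u) x).
Proof.
move=> cf ca cd; apply: continuous_addr; first exact: continuous_mulr.
by apply: continuous_mulr => //; exact: continuous_cstr.
Qed.

Lemma continuous_slide (T : topologicalType) (f : T -> X -> R) (s : T -> R) i x :
  (forall y, continuous (f^~ y)) -> continuous s ->
  (forall u, [/\ 0 <= s u <= 1, forall y, 0 <= f u y, \sum_y f u y = 1
              & regular i (f u)]) ->
  continuous (fun u => slide i (s u) (f u) x).
Proof.
move=> cf cs ok; have ch := continuous_height (i := i) cf.
apply: continuous_normalize => [y|u]; last by have [s01 t0 t1 reg] := ok u; exact: sum_cut.
have cw z : continuous (fun u => weighted (1 - s u + s u * height i (f u))
    (s u * (1 - #|opp i|%:R * height i (f u))) (f u) z).
  apply: continuous_weighted => //.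
    apply: continuous_addr; last exact: continuous_mulr.
    by apply: continuous_subr => //; exact: continuous_cstr.
  apply: continuous_mulr => //; apply: continuous_subr; first exact: continuous_cstr.
  by apply: continuous_mulr => //; exact: continuous_cstr.
apply: continuous_subr; first exact: cw.
by apply: continuous_mulr; [exact: continuous_least|exact: continuous_cstr].
Qed.

Lemma continuous_slide_all (T : topologicalType) (f : T -> realization R D)
    (s : T -> R) x :
  continuous f -> continuous s -> (forall u, 0 <= s u <= 1) ->
  continuous (fun u => slide_all (val (f u)) (s u) x).
Proof.
move=> cf cs s01; have cv y : continuous (fun u => val (f u) y).
  exact: (continuous_comp_fun cf (@continuous_coord _ _ _ y)).
have ch i := continuous_height (i := i) cv.
have cw z : continuous (fun u => weighted (1 - s u + s u * \sum_i height i (val (f u)))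
    (s u * (1 - \sum_i #|opp i|%:R * height i (val (f u)))) (val (f u)) z).
  apply: continuous_weighted => //.
    apply: continuous_addr; first by apply: continuous_subr => //; exact: continuous_cstr.
    by apply: continuous_mulr => //; exact: continuous_sum.
  apply: continuous_mulr => //; apply: continuous_subr; first exact: continuous_cstr.
  by apply: continuous_sum => i; apply: continuous_mulr => //; exact: continuous_cstr.
apply: continuous_normalize => [y|u].
  apply: continuous_subr => //; apply: continuous_sum => i.
  by apply: continuous_mulr; [exact: continuous_least|exact: continuous_cstr].
have [_ t1 _] := slide_all_in (realizationP (f u)) (s01 u).
apply: contra_eq_neq t1 => s0; rewrite /slide_all /normalize -mulr_suml s0 mul0r.
by rewrite eq_sym oner_eq0.
Qed.

Variable Phi : forall i, sphere R k -> join R (other i).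
Variable Theta : forall i, join R (other i) -> sphere R k.
Hypothesis Phi_continuous : forall i, continuous (Phi i).
Hypothesis Theta_continuous : forall i, continuous (@Theta i).
Hypothesis PhiK : forall i, cancel (Phi i) (@Theta i).
Hypothesis ThetaK : forall i, cancel (@Theta i) (Phi i).
Hypothesis Phi_base : forall i x, val (Phi i (sphere_base R k)) x = (x == y0)%:R.

Local Notation W := (wedge (fun _ : 'I_n.+1 => sphere_base R k)).
Let lift i (u : sphere R k) : W := @wedge_lift _ _ (fun _ => sphere_base R k) i u.

Let lift_base i j : lift i (sphere_base R k) = lift j (sphere_base R k).
Proof.
exact: (@wedge_liftE _ _ (fun _ => sphere_base R k)
  j (sphere_base R k) i (sphere_base R k)).
Qed.

Let continuous_lift i : continuous (@lift i).
Proof. exact (@wedge_lift_continuous _ (fun _ => sphere R k) (fun _ => sphere_base R k) i). Qed.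

Let time01 s : 0 <= clamp s <= 1.
Proof. by rewrite clamp_ge0 clamp_le1. Qed.

Let one01 : 0 <= (1 : R) <= 1. Proof. by rewrite ler01 lexx. Qed.

(** The map onto the i-th sphere that sends to [y0] all points of height 0. *)
Definition retract i (t : realization R D) : join R (other i) :=
  mk_join (retract_in (realizationP t) i).

Lemma continuous_retract i : continuous (retract i).
Proof.
apply: continuous_into => x; apply: continuous_slide; last first.
- by move=> t; have tD := realizationP t; case: (tD) => t0 t1 _; split=> //; exact: dual_regular.
- exact: continuous_cstr.
- by move=> y; exact: continuous_coord.
Qed.

Definition include i (t : join R (other i)) : realization R D :=
  mk_point (join_in (joinP t)).

Lemma continuous_include i : continuous (@include i).
Proof. by apply: continuous_into => x; exact: continuous_coord. Qed.

Definition from_wedge : W -> realization R D :=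
  wedge_fun (fun i (u : sphere R k) => include (Phi i u)).

Lemma from_wedge_agree i j :
  include (Phi i (sphere_base R k)) = include (Phi j (sphere_base R k)).
Proof. by apply: val_inj; apply/funext => x; rewrite /= !Phi_base. Qed.

Lemma from_wedge_lift i u : from_wedge (lift i u) = include (Phi i u).
Proof. by rewrite /from_wedge wedge_lift_funE //; exact: from_wedge_agree. Qed.

(** For a point of the star of [y0] any sphere would do: its retraction is the base
    point. *)
Definition to_wedge (t : realization R D) : W :=
  lift (active (val t)) (Theta (retract (active (val t)) t)).

Lemma retract_vertex i (t : realization R D) : height i (val t) = 0 ->
  Theta (retract i t) = sphere_base R k.
Proof.
move=> h0; rewrite -[RHS](PhiK i); congr Theta; apply: val_inj; apply/funext => x.
have [t0 t1 _] := realizationP t.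
by rewrite /= Phi_base height0_slide // subrr mul0r add0r mul1r.
Qed.

Lemma to_wedgeE i (t : realization R D) : isolated (val t) i ->
  to_wedge t = lift i (Theta (retract i t)).
Proof.
move=> iso; rewrite /to_wedge; have [->//|ai] := eqVneq (active (val t)) i.
rewrite retract_vertex ?iso // retract_vertex ?(lift_base _ i) //.
by apply: (isolated_active (realizationP t)); rewrite eq_sym.
Qed.

Lemma continuous_to_wedge : continuous to_wedge.
Proof.
pose Z i : set (realization R D) :=
  [set t | \sum_(j | j != i) height j (val t) = 0]%classic.
have ge0 j (t : realization R D) : 0 <= height j (val t).
  by apply: height_ge0 => x; exact: coord_ge0.
have Ziso i (t : realization R D) : Z i t <-> isolated (val t) i.
  split=> [/eqP|iso]; last by rewrite /Z /= big1.
  rewrite psumr_eq0 // => /allP h0 j ji; apply/eqP.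
  by have := h0 j; rewrite mem_index_enum ji => /(_ isT).
apply: (@continuous_closed_cover (realization R D) _ 'I_n.+1 Z to_wedge
  (fun i (t : realization R D) => lift i (Theta (retract i t)))).
- move=> i; apply: (@preimage_closed _ _ (fun t : realization R D =>
    \sum_(j | j != i) height j (val t)) [set 0]%classic); last exact: closed_eq.
  move=> t _; apply: continuous_sum => j.
  by apply: continuous_height => x; exact: continuous_coord.
- move=> t; exists (active (val t)); apply/Ziso.
  exact: isolated_active (realizationP t).
- move=> i; exact: (continuous_comp_fun (continuous_comp_fun (@continuous_retract i)
    (@Theta_continuous i)) (@continuous_lift i)).
- by move=> i t /Ziso; exact: to_wedgeE.
Qed.

Lemma continuous_from_wedge : continuous from_wedge.
Proof.
apply: wedge_fun_continuous => [i|i j]; last exact: from_wedge_agree.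
exact: (continuous_comp_fun (@Phi_continuous i) (@continuous_include i)).
Qed.

(** The composite is [slide_all] at time 1. *)
Lemma from_to_wedge : homotopic R (from_wedge \o to_wedge) id.
Proof.
apply: homotopic_sym; apply/homotopicP.
exists (fun q => mk_point (slide_all_in (realizationP q.1) (time01 q.2))).
split=> [|t|t].
- apply: continuous_into => x; apply: continuous_slide_all => //.
    exact: continuous_fst.
  exact: (continuous_comp_fun (@continuous_snd _ _) (@continuous_clamp R)).
- have tD := realizationP t; have [t0 t1 _] := tD; apply: val_inj.
  rewrite /= clamp0 (slide_allE tD _ (isolated_active tD)) ?lexx ?ler01 //.
  by rewrite slide0 //; exact: dual_regular.
- have tD := realizationP t; apply: val_inj.
  rewrite -[RHS]/(val (from_wedge (to_wedge t))) (to_wedgeE (isolated_active tD)).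
  rewrite from_wedge_lift ThetaK /= clamp1.
  by rewrite (slide_allE tD one01 (isolated_active tD)).
Qed.

Definition slide_join_at i s (t : join R (other i)) : join R (other i) :=
  mk_join (slide_join_in (joinP t) (time01 s)).

(** The composite maps every sphere to itself by its slide at time 1; the slides fix
    the base point, so that they fit together on the wedge. *)
Lemma to_from_wedge : homotopic R (to_wedge \o from_wedge) id.
Proof.
apply: homotopic_sym; apply/homotopicP.
pose K i s (u : sphere R k) : W := lift i (Theta (slide_join_at s (Phi i u))).
have K_base i s : K i s (sphere_base R k) = lift i (sphere_base R k).
  rewrite /K; congr (lift i _); rewrite -[RHS](PhiK i); congr Theta.
  apply: val_inj; apply/funext => x /=; rewrite Phi_base.
  have -> : val (Phi i (sphere_base R k)) = (fun x => (x == y0)%:R).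
    by apply/funext => z; exact: Phi_base.
  exact: slide_vertex.
have K_agree s i j : K i s (sphere_base R k) = K j s (sphere_base R k).
  by rewrite !K_base; exact: lift_base.
have KE s i u : wedge_fun (fun i => K i s) (lift i u) = K i s u.
  by rewrite wedge_lift_funE // => *; exact: K_agree.
have liftP (w : W) : exists i u, w = lift i u.
  have : [set: W]%classic w by [].
  by rewrite -wedgeTE => -[i _ [u _ <-]]; exists i, u.
exists (fun q => wedge_fun (fun i => K i q.2) q.1); split=> [|w|w].
- have K_continuous i : continuous (uncurry (K i)).
    have -> : uncurry (K i) = fun q => lift i (Theta (slide_join_at q.1 (Phi i q.2))).
      by apply/funext => -[].
    suff cS : continuous (fun q : R * sphere R k => slide_join_at q.1 (Phi i q.2)).
      exact: (continuous_comp_fun (continuous_comp_fun cS (@Theta_continuous i))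
        (@continuous_lift i)).
    apply: continuous_into => x /=.
    apply: continuous_slide => [y||q].
    * apply: (continuous_comp_fun (@continuous_snd _ _)
        (g := fun u => val (Phi i u) y)).
      exact: (continuous_comp_fun (@Phi_continuous i) (@continuous_coord _ _ _ y)).
    * exact: (continuous_comp_fun (@continuous_fst _ _) (@continuous_clamp R)).
    * have tJ := joinP (Phi i q.2); have [t0 t1 _ _] := tJ.
      by split=> //; exact: (dual_regular (join_in tJ)).
  have cK := @wedge_fun_joint_continuous _ (fun _ => sphere R k)
    (fun _ => sphere_base R k) R W K finite_finset
    (fun _ => @closed_sphere_base R k) K_agree K_continuous.
  apply: (continuous_comp_fun _ cK (f := fun q : W * R => (q.2, q.1))).
  exact: continuous_pairf (@continuous_snd _ _) (@continuous_fst _ _).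
- have [i [u ->]] := liftP w; rewrite KE /K /= -[in RHS](PhiK i u).
  congr (lift i (Theta _)); have [t0 t1 _ _] := joinP (Phi i u).
  apply: val_inj; rewrite /= clamp0 slide0 //.
  exact: (dual_regular (join_in (joinP (Phi i u)))).
- have [i [u ->]] := liftP w; rewrite KE /K -[RHS]/(to_wedge (from_wedge (lift i u))).
  rewrite from_wedge_lift.
  have iso : isolated (val (include (Phi i u))) i by exact: join_isolated (joinP _).
  rewrite (to_wedgeE iso).
  congr (lift i (Theta _)); apply: val_inj => /=.
  by rewrite clamp1.
Qed.

Lemma dual_wedge : homotopy_equivalent R (realization R D) W.
Proof.
exists to_wedge, from_wedge; split.
- exact: continuous_to_wedge.
- exact: continuous_from_wedge.
- exact: from_to_wedge.
- exact: to_from_wedge.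
Qed.

End WedgeOfJoins.
(** * Components of a graph *)

Section Components.
Variables (X : finType) (e : rel X).
Hypotheses (e_sym : symmetric e) (e_irr : irreflexive e).

Let connect_e_sym : connect_sym e.
Proof. exact: sym_connect_sym. Qed.

Lemma num_componentsE : num_components (clique_complex e) = #|[set r | roots e r]|.
Proof.
have skel : skeleton1 (clique_complex e) =2 e.
  move=> x y; rewrite /skeleton1 /= !inE; apply/andP/idP => [[xy /is_cliqueP]|exy].
    by apply; rewrite ?inE ?eqxx ?orbT.
  split; first by apply: contraTneq exy => ->; rewrite e_irr.
  apply/is_cliqueP => a b; rewrite !inE => /orP[]/eqP -> /orP[]/eqP ->;
    by rewrite ?eqxx // e_sym.
rewrite /num_components (eq_n_comp (eq_connect skel)) /n_comp_mem cardsE.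
apply: eq_card => x; rewrite !inE; rewrite (_ : is_clique e [set x]) ?andbT //.
by apply/is_cliqueP => a b; rewrite !inE => /eqP -> /eqP ->; rewrite eqxx.
Qed.

Lemma component_representatives y0 n : num_components (clique_complex e) = n.+1 ->
  exists rep : 'I_n -> X, [/\ forall i, ~~ connect e y0 (rep i),
    forall i j, connect e (rep i) (rep j) -> i = j &
    forall x, ~~ connect e y0 x -> exists i, connect e (rep i) x].
Proof.
rewrite num_componentsE => cardR; pose S := [set r | roots e r] :\ fingraph.root e y0.
have y0_root : fingraph.root e y0 \in [set r | roots e r] by rewrite inE roots_root.
have cardS : #|S| = n by move: cardR; rewrite (cardsD1 (fingraph.root e y0)) y0_root => -[].
pose rep (i : 'I_n) : X := enum_val (cast_ord (esym cardS) i).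
have repS i : rep i \in S by exact: enum_valP.
have rep_root i : fingraph.root e (rep i) = rep i.
  by apply/eqP; have := repS i; rewrite !inE => /andP[].
exists rep; split=> [i|i j|x y0x].
- rewrite -(root_connect connect_e_sym) rep_root eq_sym.
  by have := repS i; rewrite !inE => /andP[].
- rewrite -(root_connect connect_e_sym) !rep_root => /eqP/enum_val_inj.
  exact: cast_ord_inj.
have xS : fingraph.root e x \in S.
  rewrite !inE roots_root // andbT eq_sym.
  by apply: contra y0x; rewrite (root_connect connect_e_sym).
exists (cast_ord cardS (enum_rank_in xS (fingraph.root e x))).
rewrite /rep cast_ordK enum_rankK_in // connect_e_sym.
exact: connect_root.
Qed.

(** A vertex [y0] for which no component other than its own has [y0] as its only
    non-member: one in a component with an edge, or any vertex if there is no edge. *)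
Lemma connect_witness : (3 <= #|X|)%N ->
  exists y0, forall x, ~~ connect e y0 x -> exists2 z, z != y0 & ~~ connect e x z.
Proof.
move=> X3; have [/existsP[y0 /existsP[z /andP[zy yz]]]|none] :=
    boolP [exists y0, [exists z, (z != y0) && connect e y0 z]].
  exists y0 => x yx; exists z => //; apply: contra yx => xz.
  by apply: connect_trans yz _; rewrite connect_e_sym.
have [y0 _] : exists y0, y0 \in X by apply/card_gt0P; apply: leq_trans X3.
exists y0 => x yx; have /card_gt0P[z] : (0 < #|~: [set x; y0]|)%N.
  by rewrite cardsCs setCK subn_gt0 (leq_trans _ X3) // ltnS cards2; case: (x != y0).
rewrite !inE negb_or => /andP[zx zy]; exists z => //.
move: none; rewrite negb_exists => /forallP/(_ x); rewrite negb_exists => /forallP/(_ z).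
by rewrite zx.
Qed.

Lemma maximal_cliques_nonclique : (2 <= #|maximal_cliques e|)%N ->
  ~~ is_clique e [set: X].
Proof.
apply: contraL => cT; rewrite -leqNgt -(cards1 [set: X]); apply: subset_leq_card.
apply/subsetP => A; rewrite !inE => /maxsetP[_ A_max].
by rewrite -(A_max _ cT (subsetT A)).
Qed.

End Components.

(** * The dual of a chordal graph *)

Section DualOfChordal.
Variables (R : realType) (X : finType) (e : rel X) (s : seq X) (y0 : X) (n : nat).
Variable rep : 'I_n -> X.
Hypotheses (e_sym : symmetric e) (e_irr : irreflexive e).
Hypotheses (s_uniq : uniq s) (s_all : forall x, x \in s).
Hypothesis s_elim : elimination_order e s.
Hypothesis e_nonclique : ~~ is_clique e [set: X].
Hypothesis rep_far : forall i, ~~ connect e y0 (rep i).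
Hypothesis rep_inj : forall i j, connect e (rep i) (rep j) -> i = j.
Hypothesis rep_cover : forall x, ~~ connect e y0 x -> exists i, connect e (rep i) x.

Let connect_e_sym : symmetric (connect e).
Proof. exact: sym_connect_sym. Qed.

Let reps := [set rep i | i : 'I_n].

Let tau i := critical_face y0 (rep i).

Let L := noncritical_complex (connect e) y0 reps.

Let dual_collapse : collapses (clique_dual e) (clique_dual (connect e)).
Proof. exact: clique_dual_collapses s_all s_elim. Qed.

Let L_collapse : collapses L void_complex.
Proof.
apply: (noncritical_collapses (@connect0 _ e) connect_e_sym (@connect_trans _ e)).
- by move=> _ /imsetP[i _ ->].
- by move=> _ _ /imsetP[i _ ->] /imsetP[j _ ->] /rep_inj ->.
- by move=> x /rep_cover[i ix]; exists (rep i) => //; exact: imset_f.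
Qed.

Let tau_inj : injective tau.
Proof.
move=> i j ij; apply: rep_inj; have := congr1 (fun A : {set X} => rep j \in A) ij.
rewrite !inE eqxx orbT /= => /negbFE/orP[/eqP jy|/eqP -> //].
by have := rep_far j; rewrite jy connect0.
Qed.

Let tau_card i : #|tau i| = (#|X| - 2)%N.
Proof.
rewrite cardsCs setCK cards2; case: eqVneq => // y0i.
by have := rep_far i; rewrite -y0i connect0.
Qed.

Let tau_L i : tau i \notin L.
Proof.
rewrite in_noncritical negb_and; apply/orP; right; rewrite negbK.
by apply/imsetP; exists (rep i) => //; exact: imset_f.
Qed.

Let dual_faces : faces (clique_dual (connect e)) =
  [set F | (F \in L) || [exists i, F == tau i]].
Proof.
apply/setP => F; rewrite in_set in_noncritical.
have tauP : (F \in critical_faces y0 reps) = [exists i, F == tau i].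
  apply/imsetP/existsP => [[_ /imsetP[i _ ->] ->]|[i /eqP ->]]; first by exists i.
  by exists (rep i) => //; exact: imset_f.
rewrite tauP; have [/existsP[i /eqP ->]|_] := boolP [exists i, F == tau i]; last first.
  by rewrite orbF andbT.
rewrite orbT; apply/idP; rewrite -[_ \in _]/(_ \in clique_dual _) in_clique_dual setCK.
apply/not_cliqueP; exists y0, (rep i); rewrite !inE !eqxx orbT rep_far; split=> //.
by apply: contraTneq (rep_far i) => <-; rewrite connect0.
Qed.

Let card_X : (2 <= #|X|)%N.
Proof.
have /not_cliqueP[x [y [_ _ xy _]]] := e_nonclique.
have <- : #|[set x; y]| = 2%N by rewrite cards2 xy.
exact: max_card.
Qed.

(** The complex is built from the void one by collapses read backwards, which do not
    change homology, and the addition of the top faces [tau i] in between. *)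
Lemma dual_spherical_basis : spherical_basis (clique_dual e) (#|X|%:Z - 2) tau.
Proof.
have dim (r : rel X) F : F \in clique_dual r -> #|F|%:Z <= #|X|%:Z - 2.
  rewrite in_clique_dual => /not_cliqueP[x [y [xF yF xy _]]].
  have : (#|[set x; y]| <= #|~: F|)%N.
    by apply: subset_leq_card; apply/subsetP => z; rewrite !inE => /orP[]/eqP ->; rewrite -in_setC.
  have -> : #|X| = (#|F| + #|~: F|)%N by rewrite cardsC.
  by rewrite cards2 xy; lia.
apply: (spherical_basis_collapses dual_collapse); first exact: dim.
apply: (spherical_basis_facets (tau0 := fun _ => set0) tau_inj tau_L _ dual_faces).
  by move=> i; rewrite tau_card; move: card_X; move: #|X| => N; lia.
apply: (spherical_basis_collapses L_collapse).
  by move=> F; rewrite in_noncritical => /andP[/dim].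
exact: spherical_basis_void.
Qed.

Lemma dual_reduced_euler :
  reduced_euler (clique_dual e) = (-1) ^ (#|X|%:Z - 3) * n%:Z.
Proof.
rewrite (euler_collapses dual_collapse) (euler_facets tau_inj tau_L tau_card dual_faces).
rewrite (euler_collapses L_collapse) euler_void add0r card_ord; congr (_ ^ _ * _).
by move: card_X; lia.
Qed.

Let dual_nonvoid : set0 \in clique_dual e.
Proof. by rewrite in_clique_dual setC0. Qed.

(** With a single component the dual of the cluster graph is void. *)
Lemma dual_contractible : n = 0%N -> contractible R (realization R (clique_dual e)).
Proof.
move=> n0; apply: collapses_contractible => //.
rewrite (_ : void_complex = clique_dual (connect e)) //.
apply/complex_eq/setP => F; rewrite in_set0 -[RHS]/(F \in clique_dual _).
rewrite in_clique_dual; apply/esym/negbTE; rewrite negbK; apply/is_cliqueP => x y _ _ _.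
have all_y0 z : connect e y0 z.
  by apply/negPn/negP => /rep_cover[i _]; have := ltn_ord i; rewrite [X in (_ < X)%N]n0.
by apply: connect_trans (all_y0 y); rewrite connect_e_sym.
Qed.

Lemma contractible_point (T : topologicalType) : contractible R T ->
  homotopy_equivalent R T (classical_sets.set_type [set (0 : R)]%classic).
Proof.
move=> [x0 cT]; have z0 : (0 : R) \in [set (0 : R)]%classic by exact: mem_set.
pose z : classical_sets.set_type [set (0 : R)]%classic := exist _ 0 z0.
exists (fun=> z), (fun=> x0); split.
- exact: cst_continuous.
- exact: cst_continuous.
- exact: homotopic_sym.
- have -> : (fun=> z) \o (fun=> x0) = id.
    apply/funext => w; apply: val_inj.
    by rewrite /= (set_mem (valP w)).
  by apply: homotopic_refl => ?; exact: cvg_id.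
Qed.

Lemma dual_wedge_of_spheres :
  (3 <= #|X|)%N -> (forall i, exists2 z, z != y0 & ~~ connect e (rep i) z) ->
  homotopy_equivalent R (realization R (clique_dual e))
    (wedge_of_spheres R n (#|X| - 3)).
Proof.
move=> X3 far_ex.
have [n0|n_gt0] := posnP n.
  by rewrite n0; apply: contractible_point; exact: dual_contractible.
pose i0 := Ordinal n_gt0.
have D0 : set0 \in clique_dual (connect e).
  rewrite in_clique_dual setC0; apply/not_cliqueP; exists y0, (rep i0).
  rewrite !in_setT rep_far; split=> //.
  by apply: contraTneq (rep_far i0) => <-; rewrite connect0.
apply: homotopy_equivalent_trans (collapses_equivalent R dual_collapse D0) _.
case: n rep rep_far rep_inj rep_cover far_ex n_gt0 {i0 D0} => // m rep' far' inj' cover' ex' _.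
have [far farP] : exists far : 'I_m.+1 -> X,
    forall i, far i != y0 /\ ~~ connect e (rep' i) (far i).
  have exf i : exists z, z != y0 /\ ~~ connect e (rep' i) z.
    by have [z zy zr] := ex' i; exists z.
  by exists (fun i => projT1 (cid (exf i))) => i; exact: projT2 (cid (exf i)).
have cardX : #|X| = (#|X| - 3).+3 by rewrite -[LHS](subnK X3) addn3.
have homeo i : exists PT : (sphere R (#|X| - 3) -> join R (other (connect e) rep' i)) *
    (join R (other (connect e) rep' i) -> sphere R (#|X| - 3)),
  [/\ continuous PT.1, continuous PT.2, cancel PT.1 PT.2, cancel PT.2 PT.1 &
      forall x, val (PT.1 (sphere_base R (#|X| - 3))) x = (x == y0)%:R].
  have [fy fr] := farP i.
  have fA : far i \in other (connect e) rep' i by rewrite inE.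
  have rA : rep' i \notin other (connect e) rep' i by rewrite inE connect0.
  have yA : y0 \in other (connect e) rep' i by rewrite inE connect_e_sym far'.
  have yf : y0 != far i by rewrite eq_sym.
  have [P [T PT]] := join_sphere_homeo R fA rA yA yf cardX.
  by exists (P, T).
pose PT i := projT1 (cid (homeo i)).
have PTP i := projT2 (cid (homeo i)).
apply: (@dual_wedge R X (connect e) y0 (#|X| - 3) m rep' far (@connect0 _ e)
  connect_e_sym (@connect_trans _ e) far' inj' cover' _ _
  (fun i => (PT i).1) (fun i => (PT i).2)) => i.
- by have [] := farP i.
- by have [] := farP i.
- by have [] := PTP i.
- by have [] := PTP i.
- by have [] := PTP i.
- by have [] := PTP i.
- by have [] := PTP i.
Qed.

End DualOfChordal.
Theorem corollary11 (R : realType) (X : finType) (N : nat) (e : rel X)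
    (cardX : #|X| = N) (e_sym : symmetric e) (e_irr : irreflexive e)
    (e_chordal : chordal e) (two_max : (2 <= #|maximal_cliques e|)%N) :
  let Delta := clique_complex e in
  let dual := alexander_dual Delta in
  let c := num_components Delta in
  [/\ shellable dual,
      forall q : int, q != N%:Z - 3 ->
        forall z : reduced_homology dual q, z = 0
    & zmod_isomorphic (reduced_homology dual (N%:Z - 3)) 'rV[int]_(c - 1)] /\
  [/\ (3 <= N)%N ->
        homotopy_equivalent R (realization R dual)
          (wedge_of_spheres R (c - 1) (N - 3)),
      c = 1%N -> contractible R (realization R dual)
    & reduced_euler dual = (-1) ^ (N%:Z - 3) * (c%:Z - 1)].
Proof.
move=> Delta dual c; subst N.
have [s [s_uniq sE s_elim]] := chordal_elimination_order e_sym e_irr [set: X] e_chordal.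
have s_all x : x \in s by rewrite sE inE.
have nonclique := maximal_cliques_nonclique two_max.
have [x0 [_ [_ _ _ _]]] := not_cliqueP _ _ nonclique.
have [n cE] : exists n, c = n.+1.
  exists c.-1; rewrite prednK // /c num_componentsE //.
  by apply/card_gt0P; exists (fingraph.root e x0);
    rewrite inE roots_root //; exact: sym_connect_sym.
have [rep [far inj cover]] := component_representatives e_sym e_irr x0 cE.
have basis := dual_spherical_basis e_sym e_irr s_uniq s_all s_elim nonclique far inj cover.
rewrite cE subSS subn0; split; split.
- exact: (clique_dual_shellable e_sym s_uniq s_all s_elim).
- move=> q qN; apply: homology_acyclic; apply: (basis_acyclic basis).
  by apply: contra qN => /eqP qE; apply/eqP; move: qE; lia.
- apply: (homology_top (tau := fun i => critical_face x0 (rep i))).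
  by rewrite (_ : #|X|%:Z - 3 + 1 = #|X|%:Z - 2) //; lia.
- move=> X3; have [y0 y0P] := connect_witness e_sym X3.
  have [rep' [far' inj' cover']] := component_representatives e_sym e_irr y0 cE.
  apply: (dual_wedge_of_spheres R e_sym e_irr s_uniq s_all s_elim nonclique far' inj' cover') => //.
  by move=> i; exact: y0P.
- move=> [n0].
  exact: (dual_contractible R e_sym e_irr s_uniq s_all s_elim nonclique cover n0).
- rewrite -[dual]/(clique_dual e).
  rewrite (dual_reduced_euler e_sym e_irr s_uniq s_all s_elim nonclique far inj cover).
  by congr (_ * _); lia.
Qed.
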